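(* Consider the exchangeable model with independent latent factors, and the procedure ''ECA with skewed factors'' (both described in the context), with output $\widehat O=\widehat O(\theta)$ on input $\theta\in\mathbb{R}^k$ and the exact moments $\mathrm{Pairs}$, $\mathrm{Triples}(\cdot)$. Then: (1) (No false positives) For all $\theta\in\mathbb{R}^k$, the procedure returns a subset of the columns of $O$ in a canonical form; that is, there are signs $s_1,\dots,s_k\in\{-1,1\}$ such that $\widehat O\subseteq\{s_1\sigma_1O_1,\dots,s_k\sigma_kO_k\}$, where $O_i$ is the $i$-th column of $O$. (2) (Exact recovery) Assume $\gamma_i\neq 0$ for each $i\in\{1,\dots,k\}$, and let $\theta$ be a random vector uniformly distributed on the unit sphere $\mathcal{S}^{k-1}\subset\mathbb{R}^k$. Then, with probability $1$, the procedure returns all columns of $O$ in a canonical form; that is, there are signs $s_i\in\{-1,1\}$ such that $\widehat O=\{s_1\sigma_1O_1,\dots,s_k\sigma_kO_k\}$.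
   Context: Model. $h=(h_1,\dots,h_k)^\top\in\mathbb{R}^k$ is a random vector with mutually independent coordinates; $\sigma_i^2:=\mathbb{E}[(h_i-\mathbb{E}[h_i])^2]>0$ (with $\sigma_i>0$), $\mu_{i,3}:=\mathbb{E}[(h_i-\mathbb{E}[h_i])^3]$, and the skewness is $\gamma_i:=\mu_{i,3}/\sigma_i^3$. The observed vectors $x_1,x_2,x_3,\dots\in\mathbb{R}^d$, $d\ge k$, are exchangeable, conditionally independent given $h$, and $\mathbb{E}[x_v\mid h]=Oh$ for every $v$, where $O\in\mathbb{R}^{d\times k}$ has full rank $k$. All moments that appear are assumed to exist and be finite. Moments. $\mu:=\mathbb{E}[x_1]$, $\mathrm{Pairs}:=\mathbb{E}[(x_1-\mu)(x_2-\mu)^\top]$, and for $\eta\in\mathbb{R}^d$, $\mathrm{Triples}(\eta):=\mathbb{E}[(x_1-\mu)(x_2-\mu)^\top\langle\eta,x_3-\mu\rangle]$. Canonical form. $O$ is in canonical form if $\sigma_i^2=1$ for each $i$; replacing $O$ by $O\,\mathrm{diag}(\sigma_1,\dots,\sigma_k)$ (and rescaling $h$) puts $O$ in canonical form, and canonical $O$ is only specified up to the sign of each column. Pseudo-inverse. For a matrix $A$ with linearly independent columns, $A^+=(A^\top A)^{-1}A^\top$. Procedure ''ECA with skewed factors'' (input $\theta\in\mathbb{R}^k$, $\mathrm{Pairs}$, $\mathrm{Triples}(\cdot)$): (i) choose any $U\in\mathbb{R}^{d\times k}$ with $\mathrm{Range}(U)=\mathrm{Range}(\mathrm{Pairs})$;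 (ii) choose any $V\in\mathbb{R}^{k\times k}$ such that $V^\top(U^\top\mathrm{Pairs}\,U)V$ is the $k\times k$ identity, and set $W=UV$; (iii) let $\Lambda$ be the set of (unit-norm) left singular vectors of $W^\top\mathrm{Triples}(W\theta)W$ whose singular values are unique (of multiplicity one), one vector, determined up to sign, per such singular value; (iv) return $\widehat O=\{(W^+)^\top\lambda:\lambda\in\Lambda\}$. *)

(* Defs.v *)
From HB Require Import structures.
From mathcomp Require Import all_boot all_order all_algebra all_fingroup.
From mathcomp Require Import all_classical all_reals all_analysis.

Set Implicit Arguments.
Unset Strict Implicit.
Unset Printing Implicit Defensive.

Import Order.TTheory GRing.Theory Num.Theory.
Import numFieldNormedType.Exports.

Local Open Scope classical_set_scope.
Local Open Scope ring_scope.

(* R^n with its Borel sigma-algebra: a random vector in R^n under P is an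
   element of {RV P >-> borel_cV R n}. *)
Notation borel_cV R n := (g_sigma_algebraType (@open 'cV[R]_n)).

Definition dotv (R : realType) n (u v : 'cV[R]_n) : R :=
  \sum_(i < n) u i 0 * v i 0.

Section probability_notions.
Context d (T : measurableType d) (R : realType) (P : probability T R).

Definition coordinate n (X : {RV P >-> borel_cV R n}) (i : 'I_n) : T -> R :=
  fun w => (X w : 'cV[R]_n) i 0.

Definition integrable_mx m n (X : T -> 'M[R]_(m, n)) : Prop :=
  forall i j, P.-integrable setT (fun w => (X w i j)%:E).

Definition expectation_mx m n (X : T -> 'M[R]_(m, n)) : 'M[R]_(m, n) :=
  \matrix_(i, j) fine 'E_P[fun w => X w i j].

Definition stddev (X : T -> R) : R := Num.sqrt (fine 'V_P[X]).

Definition centered_power (X : T -> R) (p : nat) : T -> R :=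
  fun w => (X w - fine 'E_P[X]) ^+ p.

Definition skewness (X : T -> R) : R :=
  fine 'E_P[centered_power X 3] / stddev X ^+ 3.

Definition independent_coordinates n (X : {RV P >-> borel_cV R n}) : Prop :=
  forall (J : {set 'I_n}) (B : 'I_n -> set R),
    (forall i, measurable (B i)) ->
    P (\bigcap_(i in [set` J]) coordinate X i @^-1` B i)
    = (\prod_(i in J) P (coordinate X i @^-1` B i))%E.

(* Y is a version of E[X | h], that is, of E[X | sigma(h)]: the sets of
   sigma(h) are the h @^-1` B with B measurable. *)
Definition is_cond_expectation d' (T' : measurableType d') (h : T -> T')
    (X Y : T -> R) : Prop :=
  [/\ P.-integrable setT (EFin \o X),
      P.-integrable setT (EFin \o Y),
      measurable_fun setT (Y : g_sigma_algebra_preimageType h -> R) &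
      forall B : set T', measurable B ->
        (\int[P]_(w in h @^-1` B) (X w)%:E
         = \int[P]_(w in h @^-1` B) (Y w)%:E)%E].

(* For all measurable B_v, almost surely
     P(x_v \in B_v for all v < n | h) = prod_(v < n) P(x_v \in B_v | h);
   q v is a version of P(x_v \in B_v | h), and versions are a.s. unique.
   Other finite subfamilies are obtained by taking B_v = setT. *)
Definition cond_independent d' (T' : measurableType d') (h : T -> T')
    d'' (T'' : measurableType d'') (x : nat -> T -> T'') : Prop :=
  forall (n : nat) (B : nat -> set T''), (forall v, measurable (B v)) ->
  exists q : nat -> T -> R,
    (forall v, is_cond_expectation h \1_(x v @^-1` B v) (q v)) /\
    is_cond_expectation h \1_(\bigcap_(v in `I_n) x v @^-1` B v)
      (fun w => \prod_(v < n) q v w).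

Definition exchangeable d' (T' : measurableType d') (x : nat -> T -> T') :
    Prop :=
  forall (n : nat) (s : 'S_n) (A : set (n.-tuple T')), measurable A ->
    P [set w | A [tuple x (s v) w | v < n]] = P [set w | A [tuple x v w | v < n]].

(* The uniform distribution on the unit sphere of R^n is the unique Borel
   probability carried by the sphere that is invariant under all orthogonal
   transformations. *)
Definition uniform_on_sphere n (X : {RV P >-> borel_cV R n}) : Prop :=
  {ae P, forall w, dotv (X w) (X w) = 1} /\
  forall G : 'M[R]_n, G^T *m G = 1%:M ->
    forall B : set 'cV[R]_n, <<s open >> B ->
    P [set w | B (G *m (X w : 'cV[R]_n))] = P [set w | B (X w)].

End probability_notions.

Section factor_model.
Context d0 (T : measurableType d0) (R : realType) (P : probability T R).
Variables (k d : nat) (h : {RV P >-> borel_cV R k}).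
(* x 0, x 1, x 2, ... stand for x_1, x_2, x_3, ... *)
Variables (x : nat -> {RV P >-> borel_cV R d}) (O : 'M[R]_(d, k)).

Definition mean_x : 'cV[R]_d := expectation_mx P (x 0).

Definition centered_x (v : nat) (w : T) : 'cV[R]_d := x v w - mean_x.

Definition pairs_integrand (w : T) : 'M[R]_d :=
  centered_x 0 w *m (centered_x 1 w)^T.

Definition Pairs : 'M[R]_d := expectation_mx P pairs_integrand.

Definition triples_integrand (eta : 'cV[R]_d) (w : T) : 'M[R]_d :=
  dotv eta (centered_x 2 w) *: (centered_x 0 w *m (centered_x 1 w)^T).

Definition Triples (eta : 'cV[R]_d) : 'M[R]_d :=
  expectation_mx P (triples_integrand eta).

(* O_i in canonical form, up to sign *)
Definition canonical_col (i : 'I_k) : 'cV[R]_d :=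
  stddev P (coordinate h i) *: col i O.

Record exchangeable_factor_model : Prop := {
  factors_independent : independent_coordinates h;
  factors_integrable :
    forall i, P.-integrable setT (EFin \o coordinate h i);
  factors_moments : forall i p, p \in [:: 2%N; 3%N] ->
    P.-integrable setT (EFin \o centered_power P (coordinate h i) p);
  factors_stddev_gt0 : forall i, 0 < stddev P (coordinate h i);
  views_exchangeable : exchangeable P (fun v => x v : T -> borel_cV R d);
  views_cond_independent :
    cond_independent P h (fun v => x v : T -> borel_cV R d);
  views_cond_mean : forall v a,
    is_cond_expectation P h (coordinate (x v) a)
      (fun w => (O *m (h w : 'cV[R]_k)) a 0);
  pairs_integrable : integrable_mx P pairs_integrand;
  triples_integrable : forall eta, integrable_mx P (triples_integrand eta);
  mixing_full_rank : \rank O = k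
}.

End factor_model.

Section procedure.
Variables (R : realType) (k d : nat).

Definition pinv m n (A : 'M[R]_(m, n)) : 'M[R]_(n, m) :=
  invmx (A^T *m A) *m A^T.

Definition is_svd n (M A : 'M[R]_n) (s : 'rV[R]_n) (B : 'M[R]_n) : Prop :=
  [/\ A^T *m A = 1%:M, B^T *m B = 1%:M, forall j, 0 <= s 0 j &
      M = A *m diag_mx s *m B^T].

(* Row spaces of transposes are column spaces, so the first condition is
   Range(U) = Range(Prs). *)
Definition eca_whitening (Prs : 'M[R]_d) (U : 'M[R]_(d, k)) (V : 'M[R]_k) :
    Prop :=
  (U^T == Prs^T)%MS /\ V^T *m (U^T *m Prs *m U) *m V = 1%:M.

(* Lambda consists of the columns of the left factor A of a singular value
   decomposition whose singular value is not repeated in s; up to order, such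
   a column is determined by its singular value except for its sign. *)
Definition eca_output (Trs : 'cV[R]_d -> 'M[R]_d) (W : 'M[R]_(d, k))
    (theta : 'cV[R]_k) (Ohat : set 'cV[R]_d) : Prop :=
  exists (A : 'M[R]_k) (s : 'rV[R]_k) (B : 'M[R]_k),
    is_svd (W^T *m Trs (W *m theta) *m W) A s B /\
    Ohat = [set (pinv W)^T *m col j A
           | j in [set j | forall j', s 0 j' = s 0 j -> j' = j]].

End procedure.

Definition is_sign (R : realType) (k : nat) (s : 'I_k -> R) : Prop :=
  forall i, s i = 1 \/ s i = -1.

(* Main.v *)
(* Since the views are conditionally independent given h with mean O h, they can
   be replaced by O h inside products, one view at a time; with the independence
   of the coordinates of h this gives Pairs = O diag(sigma_i^2) O^T and
   Triples(eta) = O diag(mu_{i,3} <eta, O_i>) O^T.  For a whitening W the matrix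
   Q = W^T O diag(sigma_i) is orthogonal, (W^+)^T maps its i-th column to
   sigma_i O_i, and W^T Triples(W theta) W = Q diag(lambda_i) Q^T with
   lambda_i = gamma_i <Q_i, theta>.  Comparing a singular value decomposition
   A diag(s) B^T with this diagonalization, the orthogonal matrix Q^T A has a
   nonzero (i, j) entry only when s_j = |lambda_i|, so a singular vector with a
   simple singular value is some Q_i up to sign, and all of them occur when the
   |lambda_i| are distinct.  Since |lambda_i| = |lambda_j| confines theta to two
   hyperplanes, it remains to see that hyperplanes are null for the uniform law
   on the sphere: rotations carry a hyperplane to infinitely many equiprobable
   ones, any nonzero vector lying on boundedly many of them. *)
Require Import Defs.
From HB Require Import structures.
From mathcomp Require Import all_boot all_order all_algebra all_fingroup.
From mathcomp Require Import all_classical all_reals all_analysis.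
From mathcomp Require Import measurable_realfun.
From mathcomp Require Import ring lra.

Set Implicit Arguments.
Unset Strict Implicit.
Unset Printing Implicit Defensive.

Import Order.TTheory GRing.Theory Num.Theory.
Import numFieldNormedType.Exports.

Local Open Scope classical_set_scope.
Local Open Scope ring_scope.

(** * Integrals tested on the preimages of a map *)

Section ge0_integral_comp.
Local Open Scope ereal_scope.
Context d (T : measurableType d) d' (T' : measurableType d') (R : realType).
Variables (mu : {measure set T -> \bar R}) (e : T -> T').
Hypothesis me : measurable_fun setT e.

Import HBNNSimple.

(** Both sides are limits of integrals with [g] replaced by simple functions increasing to it. A
    simple function of [e w] splits the integral over preimages of its level sets, where the
    hypothesis applies. Nonnegativity lets monotone convergence take the limit. *)
Lemma ge0_integral_mul_comp_eq (f1 f2 : T -> R) (g : T' -> \bar R) :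
  measurable_fun setT f1 -> (forall w, 0 <= f1 w)%R ->
  measurable_fun setT f2 -> (forall w, 0 <= f2 w)%R ->
  (forall B, measurable B ->
     \int[mu]_(w in e @^-1` B) (f1 w)%:E = \int[mu]_(w in e @^-1` B) (f2 w)%:E) ->
  measurable_fun setT g -> (forall y, 0 <= g y) ->
  \int[mu]_w (g (e w) * (f1 w)%:E) = \int[mu]_w (g (e w) * (f2 w)%:E).
Proof.
move=> mf1 f10 mf2 f20 f12 mg g0.
pose a := nnsfun_approx measurableT mg.
pose aE n := EFin \o a n.
have maE n : measurable_fun setT (fun w => aE n (e w)).
  by apply: measurableT_comp => //; exact/measurable_EFinP.
have int_lim (f : T -> R) : measurable_fun setT f -> (forall w, 0 <= f w)%R ->
    \int[mu]_w (g (e w) * (f w)%:E) =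
    limn (fun n => \int[mu]_w (aE n (e w) * (f w)%:E)).
  move=> mf f0; rewrite -monotone_convergence //.
  - apply: eq_integral => w _; apply/esym/cvg_lim => //.
    by apply: cvgeZr => //; exact: cvg_nnsfun_approx.
  - by move=> n; apply: emeasurable_funM => //; exact/measurable_EFinP.
  - by move=> n w _; rewrite mule_ge0 // lee_fin.
  - move=> w _ m n mn; rewrite lee_wpmul2r ?lee_fin //.
    exact/lefP/nd_nnsfun_approx.
have int_sum (f : T -> R) n : measurable_fun setT f -> (forall w, 0 <= f w)%R ->
    \int[mu]_w (aE n (e w) * (f w)%:E) =
    \sum_(y \in range (a n))
      (y%:E * \int[mu]_(w in e @^-1` (a n @^-1` [set y])) (f w)%:E).
  move=> mf f0.
  transitivity (\int[mu]_w (\sum_(y \in range (a n))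
      (y * \1_(a n @^-1` [set y]) (e w))%:E * (f w)%:E)).
    apply: eq_integral => w _.
    rewrite -ge0_mule_fsuml => [|y]; last exact: nnfun_muleindic_ge0.
    by rewrite fsumEFin // -(fimfunE _ (e w)).
  have mI y : measurable_fun setT
      (fun w => (y * \1_(a n @^-1` [set y]) (e w))%:E).
    apply/measurable_EFinP; apply: measurable_funM => //.
    by apply: (measurableT_comp _ me).
  rewrite ge0_integral_fsum//; last 2 first.
  - by move=> y; apply: emeasurable_funM => //; exact/measurable_EFinP.
  - by move=> y w _; apply: mule_ge0; [exact: nnfun_muleindic_ge0|rewrite lee_fin].
  apply: eq_fsbigr => y /[!inE] -[y' _ <-].
  have mB : measurable (e @^-1` (a n @^-1` [set a n y'])).
    by rewrite -[X in measurable X]setTI; exact: me.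
  under eq_integral do rewrite EFinM -muleA.
  rewrite ge0_integralZl_EFin //; last 2 first.
  - by move=> w _; rewrite mule_ge0 ?lee_fin.
  - apply: emeasurable_funM; last exact/measurable_EFinP.
    by apply/measurable_EFinP/(measurableT_comp _ me).
  congr (_ * _); rewrite [RHS]integral_mkcond; apply: eq_integral => w _.
  rewrite patchE /= indicE
    (_ : (e w \in _) = (w \in e @^-1` (a n @^-1` [set a n y']))) //.
  by case: ifPn => _; rewrite ?mul1e ?mul0e.
rewrite (int_lim f1) // (int_lim f2) //; congr (limn _); apply/funext => n.
rewrite (int_sum f1) // (int_sum f2) //.
by apply: eq_fsbigr => y _; rewrite f12.
Qed.

End ge0_integral_comp.

(** * Pulling a factor out of a conditional expectation *)

Section pull_out.
Local Open Scope ereal_scope.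
Context d (T : measurableType d) (R : realType).
Variable mu : {measure set T -> \bar R}.

(** Integrability makes both integrals finite, so the subtraction of extended reals can be
    undone. *)
Lemma eq_integral_EFinP (D : set T) (f g : T -> R) : measurable D ->
  mu.-integrable D (EFin \o f) -> mu.-integrable D (EFin \o g) ->
  \int[mu]_(w in D) (f w)%:E = \int[mu]_(w in D) (g w)%:E <->
  \int[mu]_(w in D) (f w - g w)%:E = 0.
Proof.
move=> mD fi gi.
have -> : \int[mu]_(w in D) (f w - g w)%:E =
    \int[mu]_(w in D) ((f w)%:E - (g w)%:E) by [].
rewrite integralB_EFin //; split => [->|].
  by rewrite subee //; exact: integrable_fin_num gi.
have := integrable_fin_num mD fi; have := integrable_fin_num mD gi.
move: (integral _ _ _) (integral _ _ _) => [a| |] [b| |] // _ _.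
by rewrite -EFinB => -[] /subr0_eq ->.
Qed.

Context d' (T' : measurableType d').
Variable e : T -> T'.
Hypothesis me : measurable_fun setT e.

(* X^+ + Y^- and X^- + Y^+ are nonnegative with the same integral over e^-1 B, so
   they can be integrated against any nonnegative g o e; taking g = |z| 1_(y >= 0)
   and g = |z| 1_(y < 0) bounds the integral of |z Y| by that of |z X|. *)
Lemma integrable_pull_out (X Y : T -> R) (y z : T' -> R) :
  mu.-integrable setT (EFin \o X) -> mu.-integrable setT (EFin \o Y) ->
  measurable_fun setT y -> Y =1 y \o e ->
  (forall B, measurable B ->
     \int[mu]_(w in e @^-1` B) (X w)%:E = \int[mu]_(w in e @^-1` B) (Y w)%:E) ->
  measurable_fun setT z ->
  mu.-integrable setT (fun w => (z (e w) * X w)%:E) ->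
  mu.-integrable setT (fun w => (z (e w) * Y w)%:E) /\
  \int[mu]_w (z (e w) * X w)%:E = \int[mu]_w (z (e w) * Y w)%:E.
Proof.
move=> iX iY my Yy XY mz izX.
have mX : measurable_fun setT X by apply/measurable_EFinP/(measurable_int mu).
have mY : measurable_fun setT Y by apply/measurable_EFinP/(measurable_int mu).
have mzX : measurable_fun setT (fun w => z (e w) * X w)%R.
  by apply/measurable_EFinP/(measurable_int mu).
have mze : measurable_fun setT (z \o e) by exact: measurableT_comp.
pose p := (fun w => X^\+ w + Y^\- w)%R; pose m := (fun w => X^\- w + Y^\+ w)%R.
have mp : measurable_fun setT p.
  by apply: measurable_funD; [exact: measurable_funrpos|exact: measurable_funrneg].
have mm : measurable_fun setT m.
  by apply: measurable_funD; [exact: measurable_funrneg|exact: measurable_funrpos].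
have p0 w : (0 <= p w)%R by rewrite addr_ge0 ?funrpos_ge0 ?funrneg_ge0.
have m0 w : (0 <= m w)%R by rewrite addr_ge0 ?funrpos_ge0 ?funrneg_ge0.
have decomp (f : T -> R) w : (f w = f^\+ w - f^\- w)%R.
  by rewrite -[in LHS](funrposBneg f).
have absE (f : T -> R) w : (`|f w| = f^\+ w + f^\- w)%R.
  by have /(congr1 (fun g => g w)) := funrposDneg f.
have pmXY w : (p w - m w = X w - Y w)%R.
  by rewrite (decomp X) (decomp Y) /p /m; ring.
have pm B : measurable B ->
    \int[mu]_(w in e @^-1` B) (p w)%:E = \int[mu]_(w in e @^-1` B) (m w)%:E.
  move=> mB.
  have meB : measurable (e @^-1` B) by rewrite -[X in measurable X]setTI; exact: me.
  have iXB := integrableS measurableT meB (@subsetT _ _) iX.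
  have iYB := integrableS measurableT meB (@subsetT _ _) iY.
  apply/eq_integral_EFinP => //.
  - apply: (@integrableD _ _ _ _ _ meB (EFin \o X^\+%R) (EFin \o Y^\-%R)).
      exact: integrable_funrpos.
    exact: integrable_funrneg.
  - apply: (@integrableD _ _ _ _ _ meB (EFin \o X^\-%R) (EFin \o Y^\+%R)).
      exact: integrable_funrneg.
    exact: integrable_funrpos.
  under eq_integral do rewrite pmXY.
  by apply/eq_integral_EFinP => //; exact: XY.
have key (g : T' -> R) : measurable_fun setT g -> (forall t, 0 <= g t)%R ->
    \int[mu]_w (g (e w) * p w)%:E = \int[mu]_w (g (e w) * m w)%:E.
  move=> mg g0.
  have := @ge0_integral_mul_comp_eq _ _ _ _ _ _ _ me p m (EFin \o g) mp p0 mm m0 pm.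
  by apply=> //; exact/measurable_EFinP.
have dom (g : T' -> R) (f1 f2 : T -> R) : measurable_fun setT g ->
    (forall t, 0 <= g t)%R -> measurable_fun setT f1 -> measurable_fun setT f2 ->
    (forall w, 0 <= f1 w)%R -> (forall w, 0 <= f2 w)%R ->
    \int[mu]_w (g (e w) * f1 w)%:E = \int[mu]_w (g (e w) * f2 w)%:E ->
    (forall w, g (e w) * f1 w <= `|z (e w) * X w|)%R ->
    mu.-integrable setT (fun w => (g (e w) * f2 w)%:E).
  move=> mg g0 mf1 mf2 f10 f20 f12 le1; apply/integrableP; split.
    by apply/measurable_EFinP/measurable_funM => //; exact: measurableT_comp.
  under eq_integral do rewrite gee0_abs ?lee_fin ?mulr_ge0 //.
  rewrite -f12; case/integrableP : izX => _; apply: le_lt_trans.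
  apply: ge0_le_integral => //.
  - by move=> w _; rewrite lee_fin mulr_ge0.
  - by apply/measurable_EFinP/measurable_funM => //; exact: measurableT_comp.
  - by apply/measurable_EFinP; exact: measurableT_comp.
  - by move=> w _; rewrite lee_fin.
pose ge0 t : R := (0 <= y t)%R%:R; pose lt0 t : R := (y t < 0)%R%:R.
have mge0 : measurable_fun setT ge0.
  have -> : ge0 = \1_(y @^-1` `[0%R, +oo[).
    apply/funext => t; rewrite /ge0 indicE; congr (nat_of_bool _)%:R.
    by apply/idP/idP => [h|/set_mem]; [apply/mem_set|]; rewrite /= in_itv /= andbT.
  by apply: measurable_indic; rewrite -[X in measurable X]setTI; exact: my.
have mlt0 : measurable_fun setT lt0.
  have -> : lt0 = \1_(y @^-1` `]-oo, 0%R[).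
    apply/funext => t; rewrite /lt0 indicE; congr (nat_of_bool _)%:R.
    by apply/idP/idP => [h|/set_mem]; [apply/mem_set|]; rewrite /= in_itv.
  by apply: measurable_indic; rewrite -[X in measurable X]setTI; exact: my.
have mza : measurable_fun setT (fun t => `|z t|)%R by exact: measurableT_comp.
have mg1 : measurable_fun setT (fun t => `|z t| * ge0 t)%R by exact: measurable_funM.
have mg2 : measurable_fun setT (fun t => `|z t| * lt0 t)%R by exact: measurable_funM.
have g10 t : (0 <= `|z t| * ge0 t)%R by rewrite mulr_ge0 // ler0n.
have g20 t : (0 <= `|z t| * lt0 t)%R by rewrite mulr_ge0 // ler0n.
have i1 := dom _ _ _ mg1 g10 mp mm p0 m0 (key _ mg1 g10).
have i2 := dom _ _ _ mg2 g20 mm mp m0 p0 (esym (key _ mg2 g20)).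
have Yn w : (0 <= y (e w))%R -> (Y^\- w = 0)%R.
  by move=> y0; rewrite /funrneg Yy /= max_r // oppr_le0.
have Yp w : (y (e w) < 0)%R -> (Y^\+ w = 0)%R.
  by move=> y0; rewrite /funrpos Yy /= max_r // ltW.
(* Where [Y >= 0], the part [Y^\-] vanishes and [p] reduces to [X^\+], at most [|X|], so [dom]
   passes from [p] to [m]. Where [Y < 0] the two exchange roles. *)
have {}i1 : mu.-integrable setT (fun w => (`|z (e w)| * ge0 (e w) * m w)%:E).
  apply: i1 => w; rewrite normrM /p /ge0; case: (leP 0%R (y (e w))) => y0 /=.
  - by rewrite mulr1 ler_wpM2l // Yn // addr0 (absE X) lerDl funrneg_ge0.
  - by rewrite mulr0 mul0r mulr_ge0.
have {}i2 : mu.-integrable setT (fun w => (`|z (e w)| * lt0 (e w) * p w)%:E).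
  apply: i2 => w; rewrite normrM /m /lt0; case: (leP 0%R (y (e w))) => y0 /=.
  - by rewrite mulr0 mul0r mulr_ge0.
  - by rewrite mulr1 ler_wpM2l // Yp // addr0 (absE X) lerDr funrpos_ge0.
(* On each of the two sets [|Y|] is one of its own parts, bounded by [m] or by [p]. *)
have izY : mu.-integrable setT (fun w => (z (e w) * Y w)%:E).
  apply: le_integrable (integrableD measurableT i1 i2) => //.
    by apply/measurable_EFinP; exact: measurable_funM.
  move=> w _ /=; rewrite lee_fin [leRHS]ger0_norm ?addr_ge0 ?mulr_ge0 ?ler0n //.
  rewrite normrM (absE Y) /p /m /ge0 /lt0; case: (leP 0%R (y (e w))) => y0 /=.
  - rewrite Yn // mulr1 mulr0 mul0r !addr0 ler_wpM2l // lerDr funrneg_ge0 //.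
  - rewrite Yp // mulr1 mulr0 mul0r !add0r ler_wpM2l // lerDr funrpos_ge0 //.
split => //; apply/eq_integral_EFinP => //.
(* For the equality of integrals the test functions are the positive and negative parts of [z].
   Everything is now dominated by [|z X| + |z Y|], so the identities between [p] and [m] can be
   subtracted. *)
have mzp : measurable_fun setT z^\+%R by exact: measurable_funrpos.
have mzn : measurable_fun setT z^\-%R by exact: measurable_funrneg.
have ip (g : T' -> R) (f : T -> R) : measurable_fun setT g ->
    (forall t, `|g t| <= `|z t|)%R -> measurable_fun setT f ->
    (forall w, `|f w| <= `|X w| + `|Y w|)%R ->
    mu.-integrable setT (EFin \o (fun w => g (e w) * f w)%R).
  move=> mg gz mf fXY.
  have iS := integrableD measurableT (integrable_abse izX)
    (integrable_abse izY).
  apply: (le_integrable measurableT _ _ iS).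
    by apply/measurable_EFinP/measurable_funM => //; exact: measurableT_comp.
  move=> w _ /=; rewrite lee_fin [leRHS]ger0_norm ?addr_ge0 //.
  by rewrite !normrM -mulrDr ler_pM.
have zp t : (`|z^\+ t| <= `|z t|)%R.
  by rewrite ger0_norm ?funrpos_ge0 // /funrpos ge_max normr_ge0 ler_norm.
have zn t : (`|z^\- t| <= `|z t|)%R.
  by rewrite ger0_norm ?funrneg_ge0 // /funrneg ge_max normr_ge0 -normrN ler_norm.
have pXY w : (`|p w| <= `|X w| + `|Y w|)%R.
  by rewrite ger0_norm // (absE X) (absE Y) /p lerD // ?lerDl ?lerDr
    ?funrneg_ge0 ?funrpos_ge0.
have mXY w : (`|m w| <= `|X w| + `|Y w|)%R.
  by rewrite ger0_norm // (absE X) (absE Y) /m lerD // ?lerDl ?lerDr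
    ?funrneg_ge0 ?funrpos_ge0.
have e1 := (eq_integral_EFinP measurableT (ip _ _ mzp zp mp pXY) (ip _ _ mzp zp mm mXY)).1
  (key _ mzp (funrpos_ge0 _)).
have e2 := (eq_integral_EFinP measurableT (ip _ _ mzn zn mp pXY) (ip _ _ mzn zn mm mXY)).1
  (key _ mzn (funrneg_ge0 _)).
have iB f g : mu.-integrable setT (EFin \o f) -> mu.-integrable setT (EFin \o g) ->
  mu.-integrable setT (EFin \o (fun w => f w - g w)%R).
  by move=> iF iG; exact: (integrableB measurableT iF iG).
have := (eq_integral_EFinP measurableT
  (iB _ _ (ip _ _ mzp zp mp pXY) (ip _ _ mzp zp mm mXY))
  (iB _ _ (ip _ _ mzn zn mp pXY) (ip _ _ mzn zn mm mXY))).1.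
rewrite e1 e2 => /(_ erefl) <-; apply: eq_integral => w _; congr EFin.
have dz : (z (e w) = z^\+ (e w) - z^\- (e w))%R by rewrite -[in LHS](funrposBneg z).
by rewrite -!mulrBr pmXY dz; ring.
Qed.

End pull_out.

(** * Pull-out for a sigma-algebra generated by a pi-system *)

Lemma adde_finI (R : realType) (a b c : \bar R) :
  a \is a fin_num -> (a + b = a + c)%E -> b = c.
Proof.
by move=> fa abc; rewrite -(addeK b fa) -(addeK c fa) (addeC b) (addeC c) abc.
Qed.

Section generated.
Local Open Scope ereal_scope.
Context d (T : measurableType d) (R : realType).
Variables (mu : {measure set T -> \bar R}) (G : set (set T)).
Hypotheses (GI : setI_closed G) (GT : G setT) (Gm : G `<=` measurable).

Lemma measurable_id_g_sigma_algebra :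
  measurable_fun setT (id : T -> g_sigma_algebraType G).
Proof.
move=> _ B mB; rewrite setTI preimage_id.
exact: (smallest_sub (@sigma_algebra_measurable _ T) Gm).
Qed.

(** Pi-lambda argument: the measurable sets over which the two integrals agree form a Dynkin system
    containing the pi-system [G]. *)
Lemma eq_integral_g_sigma_algebra (X Y : T -> R) :
  mu.-integrable setT (EFin \o X) -> mu.-integrable setT (EFin \o Y) ->
  (forall A, G A -> \int[mu]_(w in A) (X w)%:E = \int[mu]_(w in A) (Y w)%:E) ->
  forall A, <<s G >> A -> \int[mu]_(w in A) (X w)%:E = \int[mu]_(w in A) (Y w)%:E.
Proof.
move=> iX iY XY.
rewrite -(setI_closed_g_dynkin_g_sigma_algebra GI).
pose D := [set A | measurable A /\
  \int[mu]_(w in A) (X w)%:E = \int[mu]_(w in A) (Y w)%:E].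
suff : <<d G >> `<=` D by move=> GD A /GD[].
apply: smallest_sub => [|A GA]; last by split; [exact: Gm|exact: XY].
have intU A : measurable A -> forall Z : T -> R, mu.-integrable setT (EFin \o Z) ->
  \int[mu]_w (Z w)%:E = \int[mu]_(w in A) (Z w)%:E + \int[mu]_(w in ~` A) (Z w)%:E.
  move=> mA Z iZ; rewrite -[in LHS](setUv A) integral_setU //; first exact: measurableC.
  - by rewrite setUv; exact: measurable_int iZ.
  - by rewrite disj_set2E setICr.
split.
- by split => //; exact: XY.
(* The integral over a complement is the total, which agrees because [setT] is in [G], minus a
   finite integral. *)
- move=> A [mA XYA]; split; first exact: measurableC.
  have := XY _ GT; rewrite (intU A) // (intU A mA Y) // XYA.
  have fA : \int[mu]_(w in A) (Y w)%:E \is a fin_num.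
    by apply: integrable_fin_num => //; exact: integrableS iY.
  exact: adde_finI.
- move=> F tF DF; split; first by apply: bigcup_measurable => k _; case: (DF k).
  have mF k : measurable (F k) by case: (DF k).
  have mUF : measurable (\bigcup_k F k) by exact: bigcup_measurable.
  rewrite !integral_bigcup //; [|exact: integrableS iY|exact: integrableS iX].
  by apply: eq_eseriesr => k _; case: (DF k).
Qed.

(** The map is the identity into [T] carrying the generated sigma-algebra. This allows conditioning
    on several variables at once, checked on the pi-system only. *)
Lemma integrable_pull_out_g_sigma_algebra (X Y Z : T -> R) :
  mu.-integrable setT (EFin \o X) -> mu.-integrable setT (EFin \o Y) ->
  measurable_fun setT (Y : g_sigma_algebraType G -> R) ->
  (forall A, G A -> \int[mu]_(w in A) (X w)%:E = \int[mu]_(w in A) (Y w)%:E) ->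
  measurable_fun setT (Z : g_sigma_algebraType G -> R) ->
  mu.-integrable setT (fun w => (Z w * X w)%:E) ->
  mu.-integrable setT (fun w => (Z w * Y w)%:E) /\
  \int[mu]_w (Z w * X w)%:E = \int[mu]_w (Z w * Y w)%:E.
Proof.
move=> iX iY mY XY mZ iZX.
refine (@integrable_pull_out d T R mu _ (g_sigma_algebraType G) id
  measurable_id_g_sigma_algebra X Y Y Z iX iY mY (fun=> erefl) _ mZ iZX) => A mA.
by rewrite preimage_id; exact: eq_integral_g_sigma_algebra.
Qed.

End generated.

(** * Calculus of conditional expectations *)

Section cond_expectation.
Local Open Scope ereal_scope.
Context d (T : measurableType d) (R : realType) (P : probability T R).
Context d' (T' : measurableType d') (h : T -> T').
Hypothesis mh : measurable_fun setT h.

Local Notation Th := (g_sigma_algebra_preimageType h).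

Lemma measurable_id_preimage : measurable_fun setT (id : T -> Th).
Proof.
by move=> _ _ [B mB <-]; rewrite preimage_id; apply: measurableI => //; exact: mh.
Qed.

Lemma measurable_fun_preimageT (Z : Th -> R) :
  measurable_fun setT Z -> measurable_fun setT (Z : T -> R).
Proof. by move=> mZ; exact: (measurableT_comp mZ measurable_id_preimage). Qed.

(** Taking as map the identity into [T] with the sigma-algebra of [h], rather than [h] itself,
    spares factoring [Y] and [Z] through [h]. *)
Lemma cond_expectation_pull_out (X Y Z : T -> R) :
  is_cond_expectation P h X Y -> measurable_fun setT (Z : Th -> R) ->
  P.-integrable setT (fun w => (Z w * X w)%:E) ->
  P.-integrable setT (fun w => (Z w * Y w)%:E) /\
  \int[P]_w (Z w * X w)%:E = \int[P]_w (Z w * Y w)%:E.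
Proof.
move=> [iX iY mY XY] mZ iZX.
refine (@integrable_pull_out d T R P _ Th id measurable_id_preimage X Y Y Z
  iX iY mY (fun=> erefl) _ mZ iZX).
by move=> _ [B mB <-]; rewrite preimage_id setTI; exact: XY.
Qed.

(** The test function is the indicator [Z] of the event [Y1 > Y2], which lies in the sigma-algebra
    of [h]. The product of [Z] and [Y1 - Y2] is nonnegative, while its integral is that of [Z] times
    [X1 - X2], at most zero; so it vanishes almost surely. *)
Lemma cond_expectation_le (X1 X2 Y1 Y2 : T -> R) :
  is_cond_expectation P h X1 Y1 -> is_cond_expectation P h X2 Y2 ->
  (forall w, X1 w <= X2 w)%R -> {ae P, forall w, (Y1 w <= Y2 w)%R}.
Proof.
move=> ce1 ce2 X12; case: (ce1) (ce2) => [iX1 iY1 mY1 _] [iX2 iY2 mY2 _].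
pose D : Th -> R := fun w => (Y1 w - Y2 w)%R.
have mD : measurable_fun setT D by exact: measurable_funB.
pose B : set Th := D @^-1` `]0%R, +oo[.
have mB : measurable B by rewrite -[X in measurable X]setTI; exact: mD.
pose Z : Th -> R := \1_B.
have mZ : measurable_fun setT Z by exact: measurable_indic.
have iZ (X : T -> R) : P.-integrable setT (EFin \o X) ->
    P.-integrable setT (fun w => (Z w * X w)%:E).
  move=> iX; apply: (le_integrable measurableT _ _ iX).
    apply/measurable_EFinP/measurable_funM; first exact: measurable_fun_preimageT.
    by apply/measurable_EFinP; exact: measurable_int iX.
  move=> w _ /=; rewrite lee_fin normrM ler_piMl // /Z indicE.
  by case: (_ \in _); rewrite ?normr1 ?normr0.
have [i1 e1] := cond_expectation_pull_out ce1 mZ (iZ _ iX1).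
have [i2 e2] := cond_expectation_pull_out ce2 mZ (iZ _ iX2).
have ZD0 w : (0 <= Z w * Y1 w - Z w * Y2 w)%R.
  rewrite -mulrBr /Z indicE; have [/set_mem|_] := boolP (w \in B); last by rewrite mul0r.
  by rewrite /B /= in_itv /= andbT mul1r => /ltW.
have int0 : \int[P]_w `|(Z w * Y1 w - Z w * Y2 w)%:E| = 0.
  apply/eqP; rewrite eq_le integral_ge0 // andbT.
  under eq_integral do rewrite gee0_abs ?lee_fin //.
  have -> : \int[P]_w (Z w * Y1 w - Z w * Y2 w)%:E =
     \int[P]_w ((Z w * Y1 w)%:E - (Z w * Y2 w)%:E) by [].
  rewrite integralB_EFin // -e1 -e2 -integralB_EFin ?iZ //.
  rewrite -[leRHS](@integral0 _ _ _ P setT); apply: le_integral => //.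
  - exact: integrableB (iZ _ iX1) (iZ _ iX2).
  - exact: integrable0.
  - move=> w _ /=; rewrite lee_fin -mulrBr.
    by apply: mulr_ge0_le0; [rewrite /Z indicE|rewrite subr_le0].
have := (ae_eq_integral_abs P measurableT _).1 int0.
case.
  by apply/measurable_EFinP/measurable_funB; apply/measurable_EFinP;
    exact: (measurable_int P).
move=> N [mN PN sN]; exists N; split => // w /= /negP; rewrite -ltNge => ltY.
apply: sN => /=.
move=> /(_ I) [] /eqP; rewrite -mulrBr /Z indicE mem_set ?mul1r ?subr_eq0.
  by move=> /eqP eY; rewrite eY ltxx in ltY.
by rewrite /B /= in_itv /= subr_gt0 ltY.
Qed.

Lemma cond_expectation_unique (X Y1 Y2 : T -> R) :
  is_cond_expectation P h X Y1 -> is_cond_expectation P h X Y2 ->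
  {ae P, forall w, Y1 w = Y2 w}.
Proof.
move=> ce1 ce2; have := cond_expectation_le ce1 ce2 (fun _ => lexx _).
have := cond_expectation_le ce2 ce1 (fun _ => lexx _).
by apply: filterS2 => w le1 le2; apply/eqP; rewrite eq_le le1 le2.
Qed.

Lemma cond_expectation_cst (c : R) : is_cond_expectation P h (cst c) (cst c).
Proof.
have ic : P.-integrable setT (EFin \o cst c) by exact: finite_measure_integrable_cst.
by split => //; exact: measurable_cst.
Qed.

Lemma cond_expectationD (X1 X2 Y1 Y2 : T -> R) :
  is_cond_expectation P h X1 Y1 -> is_cond_expectation P h X2 Y2 ->
  is_cond_expectation P h (fun w => X1 w + X2 w)%R (fun w => Y1 w + Y2 w)%R.
Proof.
move=> [iX1 iY1 mY1 XY1] [iX2 iY2 mY2 XY2]; split.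
- exact: (integrableD measurableT iX1 iX2).
- exact: (integrableD measurableT iY1 iY2).
- exact: measurable_funD.
- move=> B mB; have mhB : measurable (h @^-1` B).
    by rewrite -[X in measurable X]setTI; exact: mh.
  have iS (X : T -> R) : P.-integrable setT (EFin \o X) ->
    P.-integrable (h @^-1` B) (EFin \o X) by exact: integrableS.
  have := integralD_EFin mhB (iS _ iX1) (iS _ iX2).
  have := integralD_EFin mhB (iS _ iY1) (iS _ iY2).
  by rewrite /= => -> ->; rewrite XY1 // XY2.
Qed.

Lemma cond_expectationZ (c : R) (X Y : T -> R) :
  is_cond_expectation P h X Y ->
  is_cond_expectation P h (fun w => c * X w)%R (fun w => c * Y w)%R.
Proof.
move=> [iX iY mY XY]; split.
- exact: (integrableZl measurableT c iX).
- exact: (integrableZl measurableT c iY).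
- exact: measurable_funM.
- move=> B mB; have mhB : measurable (h @^-1` B).
    by rewrite -[X in measurable X]setTI; exact: mh.
  have iS (Z : T -> R) : P.-integrable setT (EFin \o Z) ->
    P.-integrable (h @^-1` B) (EFin \o Z) by exact: integrableS.
  have := integralZl mhB (iS _ iX) c; have := integralZl mhB (iS _ iY) c.
  by rewrite /= => -> ->; rewrite XY.
Qed.

Lemma cond_expectation_sum (I : Type) (s : seq I) (X Y : I -> T -> R) :
  (forall i, is_cond_expectation P h (X i) (Y i)) ->
  is_cond_expectation P h (fun w => \sum_(i <- s) X i w)%R
    (fun w => \sum_(i <- s) Y i w)%R.
Proof.
move=> XY; elim: s => [|i s IH].
  by under [X in is_cond_expectation P h X _]eq_fun do rewrite big_nil;
     under [X in is_cond_expectation P h _ X]eq_fun do rewrite big_nil;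
     exact: cond_expectation_cst.
under [X in is_cond_expectation P h X _]eq_fun do rewrite big_cons.
under [X in is_cond_expectation P h _ X]eq_fun do rewrite big_cons.
exact: cond_expectationD.
Qed.

(** Null sets need not lie in the sigma-algebra of [h], hence the separate measurability condition
    on [Y']. *)
Lemma cond_expectation_ae (X Y Y' : T -> R) :
  is_cond_expectation P h X Y -> measurable_fun setT (Y' : Th -> R) ->
  {ae P, forall w, Y w = Y' w} -> is_cond_expectation P h X Y'.
Proof.
move=> [iX iY mY XY] mY' YY'.
have mYT := measurable_fun_preimageT mY.
have mY'T := measurable_fun_preimageT mY'.
have ae_abs : ae_eq P setT (abse \o (EFin \o Y)) (abse \o (EFin \o Y')).
  by apply: filterS YY' => w /= ->.
have mE (Z : T -> R) B : measurable_fun setT Z -> measurable_fun B (EFin \o Z).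
  by move=> mZ; apply: measurable_funTS; exact/measurable_EFinP.
split => //.
- apply/integrableP; split; first exact: mE.
  case/integrableP : iY => _; congr (_ < _).
  apply: ae_eq_integral => //; apply: measurableT_comp => //; exact: mE.
- move=> B mB; have mhB : measurable (h @^-1` B).
    by rewrite -[X in measurable X]setTI; exact: mh.
  rewrite XY //; apply: ae_eq_integral => //; [exact: mE|exact: mE|].
  by apply: filterS YY' => w /= -> _.
Qed.

(** Clamping a version to the unit interval changes it on a null set only, by comparison with the
    constants 0 and 1. The bound makes products with integrable functions integrable. *)
Lemma cond_expectation_indic_bounded (A : set T) (q : T -> R) :
  is_cond_expectation P h \1_A q ->
  exists2 q' : T -> R, is_cond_expectation P h \1_A q' &
    forall w, (`|q' w| <= 1)%R.
Proof.
move=> ceq; exists (fun w => Num.max (Num.min (q w) 1) 0)%R; last first.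
  move=> w; rewrite ger0_norm ?le_max ?lexx ?orbT //.
  by rewrite ge_max ge_min lexx orbT ler01.
apply: (cond_expectation_ae ceq).
  case: ceq => _ _ mq _; apply: measurable_maxr => //; exact: measurable_minr.
have le1 := cond_expectation_le ceq (cond_expectation_cst 1%R).
have ge0 := cond_expectation_le (cond_expectation_cst 0%R) ceq.
have A1 : {ae P, forall w, (q w <= 1)%R}.
  by apply: le1 => w; rewrite indicE; case: (_ \in _).
have A2 : {ae P, forall w, (0 <= q w)%R}.
  by apply: ge0 => w; rewrite indicE; case: (_ \in _).
by move: A1 A2; apply: filterS2 => w /= q1 q0; rewrite min_l // max_l.
Qed.

End cond_expectation.

(** * Replacing one view by its conditional mean *)

Section indic_integral.
Local Open Scope ereal_scope.
Context d (T : measurableType d) (R : realType).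
Variable mu : {measure set T -> \bar R}.

Lemma integral_indicM (D : set T) (f : T -> R) :
  \int[mu]_(w in D) (f w)%:E = \int[mu]_w (\1_D w * f w)%:E.
Proof.
rewrite integral_mkcond; apply: eq_integral => w _; rewrite patchE indicE.
by case: (w \in D); rewrite ?mul1r ?mul0r.
Qed.

Lemma le_integrable_EFin (f g : T -> R) : measurable_fun setT f ->
  (forall w, `|f w| <= `|g w|)%R ->
  mu.-integrable setT (EFin \o g) -> mu.-integrable setT (EFin \o f).
Proof.
move=> mf fg; apply: le_integrable => //; first exact/measurable_EFinP.
by move=> w _ /=; rewrite lee_fin.
Qed.

Lemma integrable_boundedM (f g : T -> R) : measurable_fun setT f ->
  (forall w, `|f w| <= 1)%R -> mu.-integrable setT (EFin \o g) ->
  mu.-integrable setT (fun w => (f w * g w)%:E).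
Proof.
move=> mf f1 ig; apply: (le_integrable_EFin _ _ ig).
  by apply: measurable_funM => //; apply/measurable_EFinP; exact: measurable_int ig.
by move=> w; rewrite normrM ler_piMl.
Qed.

End indic_integral.

Lemma normr_indic_le1 (R : numDomainType) (T : Type) (A : set T) (w : T) :
  `|\1_A w : R| <= 1.
Proof. by rewrite indicE; case: (_ \in _); rewrite ?normr1 ?normr0. Qed.

Section cond_independence.
Local Open Scope ereal_scope.
Context d (T : measurableType d) (R : realType) (P : probability T R).
Context d' (T' : measurableType d') (h : T -> T').
Hypothesis mh : measurable_fun setT h.
Context d'' (T'' : measurableType d'') (x : nat -> T -> T'').
Hypothesis mx : forall v, measurable_fun setT (x v).
Hypothesis xh : cond_independent P h x.

Local Notation Th := (g_sigma_algebra_preimageType h).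

Let mhB (B : set T') : measurable B -> measurable (h @^-1` B).
Proof. by move=> mB; rewrite -[X in measurable X]setTI; exact: mh. Qed.

Let mhBh (B : set T') : measurable B -> measurable (h @^-1` B : set Th).
Proof. by move=> mB; exists B; rewrite ?setTI. Qed.

Let mxB v (B : set T'') : measurable B -> measurable (x v @^-1` B).
Proof. by move=> mB; rewrite -[X in measurable X]setTI; exact: mx. Qed.

Let mcap n (B : nat -> set T'') : (forall v, measurable (B v)) ->
  measurable (\bigcap_(v in `I_n) x v @^-1` B v).
Proof.
move=> mB; apply: fin_bigcap_measurable => [|v _]; first exact: finite_II.
exact: mxB.
Qed.

(** The factorization is applied to two families that differ at [m] only, with [setT] and [B0]
    there. Uniqueness of versions identifies the other factors, and the factor for [setT] is 1
    almost surely, so the two products differ by the factor [q]. *)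
Lemma cond_independent_split n m (B : nat -> set T'') (qA : T -> R) B0 :
  (m < n)%N -> (forall v, measurable (B v)) -> B m = setT -> measurable B0 ->
  is_cond_expectation P h \1_(\bigcap_(v in `I_n) x v @^-1` B v) qA ->
  exists2 q, is_cond_expectation P h \1_(x m @^-1` B0) q &
    is_cond_expectation P h
      (\1_((\bigcap_(v in `I_n) x v @^-1` B v) `&` x m @^-1` B0))
      (fun w => qA w * q w)%R.
Proof.
move=> mn mB Bm mB0 ceA.
pose B' v := if v == m then B0 else B v.
have mB' v : measurable (B' v) by rewrite /B'; case: ifP.
have [q [qB qprod]] := xh n mB.
have [q' [qB' qprod']] := xh n mB'.
have ceB0 : is_cond_expectation P h \1_(x m @^-1` B0) (q' m).
  by have := qB' m; rewrite /B' eqxx.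
exists (q' m) => //.
have <- : \bigcap_(v in `I_n) x v @^-1` B' v =
    (\bigcap_(v in `I_n) x v @^-1` B v) `&` x m @^-1` B0.
  apply/seteqP; split => w /=.
    move=> H; split; last by have := H m mn; rewrite /B' eqxx.
    move=> v vn /=; have [->|vm] := eqVneq v m; first by rewrite Bm.
    by have := H v vn; rewrite /B' (negbTE vm).
  by move=> [H1 H2] v vn; rewrite /B'; case: eqVneq => [->//|_]; exact: H1.
apply: (cond_expectation_ae mh qprod').
  apply: measurable_funM; first by case: ceA.
  by case: ceB0.
have ae1 : {ae P, forall w, q m w = 1%R}.
  have := qB m; rewrite Bm preimage_setT indicT => ce1.
  exact: cond_expectation_unique ce1 (cond_expectation_cst P h 1%R).
have ae2 : {ae P, forall w, (\prod_(v < n) q v w)%R = qA w}.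
  exact: cond_expectation_unique qprod ceA.
have ae3 : {ae P, forall w, forall v : 'I_n, v != m :> nat -> q' v w = q v w}.
  apply: filter_forall => v; have [->|vm] := eqVneq (v : nat) m.
    by apply: nearW.
  have := qB' v; rewrite /B' (negbTE vm) => ce1.
  by have := cond_expectation_unique mh ce1 (qB v); apply: filterS => w ->.
move: ae1 ae2 ae3; apply: filterS3 => w e1 e2 e3.
rewrite -e2 (bigD1 (Ordinal mn)) //= [in RHS](bigD1 (Ordinal mn)) //= e1 mul1r mulrC.
congr (_ * _)%R; apply: eq_bigr => v vm; apply: e3.
by apply: contraNneq vm => vm; apply/eqP/val_inj.
Qed.

Lemma cond_independent_replace n m (B : nat -> set T'') (f : T'' -> R) (Y : T -> R)
    (C : set T') :
  (m < n)%N -> (forall v, measurable (B v)) -> B m = setT ->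
  measurable_fun setT f -> is_cond_expectation P h (f \o x m) Y -> measurable C ->
  \int[P]_(w in (\bigcap_(v in `I_n) x v @^-1` B v) `&` h @^-1` C) (f (x m w))%:E =
  \int[P]_(w in (\bigcap_(v in `I_n) x v @^-1` B v) `&` h @^-1` C) (Y w)%:E.
Proof.
move=> mn mB Bm mf ceF mC; set A := \bigcap_(v in _) _.
have mA : measurable A by exact: mcap.
have mhC := mhB mC.
have [q0 [_ /(cond_expectation_indic_bounded mh)]] := xh n mB.
move=> [qA ceA qA1]; case: (ceA) => [iA iqA mqAh _].
have mqA := measurable_fun_preimageT mh mqAh.
case: (ceF) => [iF iY mYh _].
have mY := measurable_fun_preimageT mh mYh.
pose c : T -> R := \1_(h @^-1` C).
have mc : measurable_fun setT c by exact: measurable_indic.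
have mch : measurable_fun setT (c : Th -> R) by apply: measurable_indic; exact: mhBh.
have c1 w : (`|c w| <= 1)%R by exact: normr_indic_le1.
have A1 w : (`|\1_A w : R| <= 1)%R by exact: normr_indic_le1.
have AC w : (\1_(A `&` h @^-1` C) w = \1_A w * c w :> R)%R by rewrite indicI.
have bM (f1 f2 : T -> R) : (forall w, `|f1 w| <= 1)%R -> (forall w, `|f2 w| <= 1)%R ->
  forall w, (`|f1 w * f2 w| <= 1)%R by move=> h1 h2 w; rewrite normrM mulr_ile1.
have mAc : measurable_fun setT (fun w => \1_A w * c w : R)%R by exact: measurable_funM.
have mqc : measurable_fun setT (fun w => qA w * c w)%R by exact: measurable_funM.
have iAF := integrable_boundedM mAc (bM _ _ A1 c1) iF.
have iqF := integrable_boundedM mqc (bM _ _ qA1 c1) iF.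
have icA : P.-integrable setT (EFin \o (fun w => \1_A w * c w)%R).
  have := integrable_boundedM mc c1 iA.
  by apply: eq_integrable => // w _ /=; rewrite mulrC.
have icq : P.-integrable setT (EFin \o (fun w => qA w * c w)%R).
  have := integrable_boundedM mc c1 iqA.
  by apply: eq_integrable => // w _ /=; rewrite mulrC.
rewrite [LHS]integral_indicM [RHS]integral_indicM.
(* By [cond_independent_split], the difference [zeta] integrates to zero over every event of [x m];
   pulling out [f (x m)] gives a zero integral against it too. *)
transitivity (\int[P]_w (qA w * c w * f (x m w))%:E).
  pose zeta w := (\1_A w * c w - qA w * c w)%R.
  have izeta : P.-integrable setT (EFin \o zeta) by exact: (integrableB measurableT icA icq).
  have i0 : P.-integrable setT (EFin \o (cst 0%R : T -> R)).
    exact: finite_measure_integrable_cst.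
  have zeta0 B0 : measurable B0 -> \int[P]_(w in x m @^-1` B0) (zeta w)%:E =
      \int[P]_(w in x m @^-1` B0) (cst 0%R w)%:E.
    move=> mB0; rewrite integral0.
    have [q ceB0 ceAB] := cond_independent_split mn mB Bm mB0 ceA.
    case: (ceB0) => [iB0 iq _ _].
    have iBc := integrable_boundedM mqc (bM _ _ qA1 c1) iB0.
    have mqch : measurable_fun setT ((fun w => qA w * c w)%R : Th -> R).
      exact: measurable_funM.
    have [_ e1] := cond_expectation_pull_out mh ceB0 mqch iBc.
    case: (ceAB) => [_ _ _ /(_ _ mC)];
    rewrite [X in X = _ -> _]integral_indicM [X in _ = X -> _]integral_indicM => e2.
    apply/eq_integral_EFinP; first exact: mxB.
      by apply: integrableS icA => //; exact: mxB.
      by apply: integrableS icq => //; exact: mxB.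
    rewrite [LHS]integral_indicM [RHS]integral_indicM.
    transitivity (\int[P]_w (c w * \1_(A `&` x m @^-1` B0) w)%:E).
      by apply: eq_integral => w _; rewrite indicI /=; congr EFin; ring.
    rewrite e2; transitivity (\int[P]_w (qA w * c w * q w)%:E).
      by apply: eq_integral => w _; congr EFin; rewrite /c; ring.
    by rewrite -e1; apply: eq_integral => w _; congr EFin; ring.
  have izF : P.-integrable setT (fun w => (f (x m w) * zeta w)%:E).
    have := integrableB measurableT iAF iqF; apply: eq_integrable => // w _ /=.
    by rewrite -EFinB; congr EFin; rewrite /zeta; ring.
  have [_] := @integrable_pull_out d T R P _ _ (x m) (mx m) zeta (cst 0%R) (cst 0%R) f
    izeta i0 (measurable_cst _) (fun=> erefl) zeta0 mf izF.
  rewrite [RHS]integral0_eq => [H|w _]; last by rewrite mulr0.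
  apply/eq_integral_EFinP => //.
    by apply: eq_integrable iAF => // w _ /=; rewrite AC.
  by rewrite -H; apply: eq_integral => w _; rewrite AC /zeta; congr EFin; ring.
(* The factor [qA * c] is measurable for [h], which turns [f (x m)] into [Y]. Then [Y * c] is pulled
   out to return from [qA] to [1_A]. *)
have [iqY ->] := cond_expectation_pull_out mh ceF (measurable_funM mqAh mch) iqF.
have iAY : P.-integrable setT (fun w => (Y w * c w * \1_A w)%:E).
  have := integrable_boundedM mAc (bM _ _ A1 c1) iY.
  by apply: eq_integrable => // w _ /=; congr EFin; ring.
have [_ e1] := cond_expectation_pull_out mh ceA (measurable_funM mYh mch) iAY.
transitivity (\int[P]_w (Y w * c w * qA w)%:E).
  by apply: eq_integral => w _ /=; congr EFin; ring.
by rewrite -e1; apply: eq_integral => w _; rewrite AC /=; congr EFin; ring.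
Qed.

End cond_independence.

(** * Products of functions of conditionally independent views *)

Section cond_independence_prod.
Local Open Scope ereal_scope.
Context d (T : measurableType d) (R : realType) (P : probability T R).
Context d' (T' : measurableType d') (h : T -> T').
Hypothesis mh : measurable_fun setT h.
Context d'' (T'' : measurableType d'') (x : nat -> T -> T'').
Hypothesis mx : forall v, measurable_fun setT (x v).
Hypothesis xh : cond_independent P h x.
Variables (f : nat -> T'' -> R) (Y : nat -> T -> R).
Hypothesis mf : forall v, measurable_fun setT (f v).
Hypothesis ceY : forall v, is_cond_expectation P h (f v \o x v) (Y v).

(** A pi-system for [h] and the views below [n] other than [k]: the condition [B k = setT] leaves
    view [k] free. *)
Let others n k : set (set T) := [set A | exists (B : nat -> set T'') (C : set T'),
  [/\ forall v, measurable (B v), B k = setT, measurable C &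
    A = (\bigcap_(v in `I_n) x v @^-1` B v) `&` h @^-1` C]].

Let others_setI n k : setI_closed (others n k).
Proof.
move=> _ _ [B1 [C1 [mB1 B1k mC1 ->]]] [B2 [C2 [mB2 B2k mC2 ->]]].
exists (fun v => B1 v `&` B2 v), (C1 `&` C2); split.
- by move=> v; exact: measurableI.
- by rewrite B1k B2k setIT.
- exact: measurableI.
- apply/seteqP; split => w /= => [[[H1 h1] [H2 h2]]|[H [h1 h2]]].
    by split => [v vn|]; split => //; [exact: H1|exact: H2].
  by split; split => // v vn; case: (H v vn).
Qed.

Let others_setT n k : others n k setT.
Proof.
exists (fun=> setT), setT; split => //.
by apply/seteqP; split => w //=; split.
Qed.

Let others_measurable n k : others n k `<=` measurable.
Proof.
move=> _ [B [C [mB _ mC ->]]]; apply: measurableI.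
  apply: fin_bigcap_measurable => [|v _]; first exact: finite_II.
  by rewrite -[X in measurable X]setTI; exact: mx.
by rewrite -[X in measurable X]setTI; exact: mh.
Qed.

Let Tothers n k := g_sigma_algebraType (others n k).

Let mY_others n k v : measurable_fun setT (Y v : Tothers n k -> R).
Proof.
move=> _ D mD; have [_ _ mYv _] := ceY v; have [C mC CE] := mYv measurableT D mD.
apply: sub_sigma_algebra; exists (fun=> setT), C; split => //.
by rewrite -CE; apply/seteqP; split => w //= [].
Qed.

Let mf_others n k v : v != k -> (v < n)%N ->
  measurable_fun setT ((f v \o x v) : Tothers n k -> R).
Proof.
move=> vk vn _ D mD; apply: sub_sigma_algebra.
exists (fun u => if u == v then f v @^-1` D else setT), setT; split => //.
- move=> u; case: ifP => // _; rewrite -[X in measurable X]setTI; exact: mf.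
- by rewrite eq_sym (negbTE vk).
- apply/seteqP; split => w /=.
    by move=> [_ H]; split => // u un; case: eqVneq => [->|//].
  by move=> [H _]; split => //; have := H v vn; rewrite eqxx.
Qed.

(* The views are replaced by their conditional means one at a time; each
   replacement is a pull-out for the sigma-algebra of h and the other views. *)
Theorem integral_cond_independent_prod n :
  P.-integrable setT (fun w => (\prod_(v < n) f v (x v w))%:E) ->
  P.-integrable setT (fun w => (\prod_(v < n) Y v w)%:E) /\
  \int[P]_w (\prod_(v < n) f v (x v w))%:E = \int[P]_w (\prod_(v < n) Y v w)%:E.
Proof.
move=> iX.
pose F k v w := if (v < k)%N then Y v w else f v (x v w).
have key k : (k <= n)%N ->
    P.-integrable setT (fun w => (\prod_(v < n) F k v w)%:E) /\
    \int[P]_w (\prod_(v < n) f v (x v w))%:E = \int[P]_w (\prod_(v < n) F k v w)%:E.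
  elim: k => [|k IH kn]; first by [].
  have [iM eM] := IH (ltnW kn).
  pose Z w := (\prod_(v < n | (v != k :> nat)) F k v w)%R.
  have MZ w : (\prod_(v < n) F k v w = Z w * f k (x k w))%R.
    by rewrite (bigD1 (Ordinal kn)) //= mulrC /F ltnn.
  have MZ' w : (\prod_(v < n) F k.+1 v w = Z w * Y k w)%R.
    rewrite (bigD1 (Ordinal kn)) //= {1}/F ltnSn mulrC; congr (_ * _)%R.
    by apply: eq_bigr => v /negPf vk; rewrite /F ltnS leq_eqVlt
      (vk : (v == k :> nat) = false).
  have mZ : measurable_fun setT (Z : Tothers n k -> R).
    rewrite /Z; under [X in measurable_fun _ X]eq_fun do rewrite big_mkcond.
    apply: measurable_prod => v _; case: (boolP (v != k :> nat)) => // vk.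
    by rewrite /F; case: (v < k)%N; [exact: mY_others|exact: mf_others].
  have ceX := ceY k; case: (ceX) => iXk iYk _ _.
  have {}iM : P.-integrable setT (fun w => (Z w * f k (x k w))%:E).
    by apply: eq_integrable iM => // w _; rewrite MZ.
  have fY A : others n k A ->
      \int[P]_(w in A) (f k (x k w))%:E = \int[P]_(w in A) (Y k w)%:E.
    move=> [B [C [mB Bk mC ->]]].
    exact: cond_independent_replace.
  have [iM' eM'] := integrable_pull_out_g_sigma_algebra (@others_setI n k)
    (others_setT n k) (@others_measurable n k) iXk iYk (@mY_others n k k) fY mZ iM.
  split; first by apply: eq_integrable iM' => // w _; rewrite MZ'.
  rewrite eM; under eq_integral do rewrite MZ.
  by rewrite eM'; under [RHS]eq_integral do rewrite MZ'.
have [iM eM] := key n (leqnn n).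
have MY w : (\prod_(v < n) F n v w = \prod_(v < n) Y v w)%R.
  by apply: eq_bigr => v _; rewrite /F ltn_ord.
split; first by apply: eq_integrable iM => // w _; rewrite MY.
by rewrite eM; under eq_integral do rewrite MY.
Qed.

End cond_independence_prod.

(** * Independent coordinates and products of centred ones *)

Lemma continuous_measurable_borel_cV (R : realType) n (f : 'cV[R]_n -> R) :
  continuous f -> measurable_fun setT (f : borel_cV R n -> R).
Proof.
move=> /continuousP cf; apply: (measurability _ (RGenOpens.measurableE R)).
move=> _ [_ [a [b ->] <-]]; rewrite setTI; apply: sub_sigma_algebra.
exact/cf/interval_open.
Qed.

Lemma measurable_coord (R : realType) n (i : 'I_n) :
  measurable_fun setT ((fun v : 'cV[R]_n => v i 0) : borel_cV R n -> R).
Proof. by apply: continuous_measurable_borel_cV; exact: coord_continuous. Qed.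

Section independence.
Local Open Scope ereal_scope.
Context d (T : measurableType d) (R : realType) (P : probability T R) (k : nat).
Variable h : {RV P >-> borel_cV R k}.

Lemma measurable_coordinate i : measurable_fun setT (coordinate h i).
Proof. exact: (measurableT_comp (measurable_coord i) (measurable_funP h)). Qed.

Let mhB i (B : set R) : measurable B -> measurable (coordinate h i @^-1` B).
Proof. by move=> mB; rewrite -[X in measurable X]setTI; exact: measurable_coordinate. Qed.

Hypothesis ind : independent_coordinates h.
Hypothesis ih : forall i, P.-integrable setT (EFin \o coordinate h i).

(** Indexed by the full finite set, the form in which the independence hypothesis yields a
    product. *)
Let cyl (B : 'I_k -> set R) :=
  \bigcap_(j in [set` [set: 'I_k]%SET]) coordinate h j @^-1` B j.

Let others i : set (set T) := [set A | exists B : 'I_k -> set R,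
  [/\ forall j, measurable (B j), B i = setT & A = cyl B]].

Let mcyl B : (forall j, measurable (B j)) -> measurable (cyl B).
Proof.
move=> mB; apply: fin_bigcap_measurable => [|j _]; first exact: finite_finset.
exact: mhB.
Qed.

Let others_setI i : setI_closed (others i).
Proof.
move=> _ _ [B1 [mB1 B1i ->]] [B2 [mB2 B2i ->]].
exists (fun v => B1 v `&` B2 v); split.
- by move=> v; exact: measurableI.
- by rewrite B1i B2i setIT.
- apply/seteqP; split => w /= => [[H1 H2] v vn|H].
    by split; [exact: H1|exact: H2].
  by split => v vn; case: (H v vn).
Qed.

Let others_setT i : others i setT.
Proof. by exists (fun=> setT); split => //; apply/seteqP; split => w. Qed.

Let others_measurable i : others i `<=` measurable.
Proof. by move=> _ [B [mB _ ->]]; exact: mcyl. Qed.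

Let Tothers i := g_sigma_algebraType (others i).

Let mcoord_others i j : j != i -> measurable_fun setT (coordinate h j : Tothers i -> R).
Proof.
move=> ji _ D mD; apply: sub_sigma_algebra.
exists (fun l => if l == j then D else setT); split.
- by move=> l; case: ifP.
- by rewrite eq_sym (negbTE ji).
- apply/seteqP; split => w /=.
    by move=> [_ H] l _ /=; case: eqVneq => [->|].
  by move=> H; split => //; have := H j; rewrite /= eqxx; apply; rewrite inE.
Qed.

(** Independence over the full index set is used twice, with [setT] and with [B0] at [i]; the two
    products differ by one factor. *)
Let P_others i A B0 : others i A -> measurable B0 ->
  P (A `&` coordinate h i @^-1` B0) = P A * P (coordinate h i @^-1` B0).
Proof.
move=> [B [mB Bi ->]] mB0.
pose B' j := if j == i then B0 else B j.
have mB' j : measurable (B' j) by rewrite /B'; case: ifP.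
have -> : cyl B `&` coordinate h i @^-1` B0 = cyl B'.
  apply/seteqP; split => w /=.
    by move=> [H1 H2] j _; rewrite /= /B'; case: eqVneq => [->//|_]; apply: H1; rewrite /= inE.
  move=> H; split; last by have := H i; rewrite /= /B' eqxx; apply; rewrite inE.
  move=> j _ /=; have [->|ji] := eqVneq j i; first by rewrite Bi.
  by have := H j; rewrite /= /B' (negbTE ji); apply; rewrite inE.
rewrite /cyl !ind // (bigD1 i) ?inE //= [in RHS](bigD1 i) ?inE //= {1}/B' eqxx Bi.
rewrite preimage_setT probability_setT mul1e muleC; congr (_ * _).
by apply: eq_bigr => j /andP[_ ji]; rewrite /B' (negbTE ji).
Qed.

Definition centered_coordinate i : T -> R :=
  fun w => (coordinate h i w - fine 'E_P[coordinate h i])%R.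

Local Notation H := centered_coordinate.

Lemma measurable_centered_coordinate i : measurable_fun setT (H i).
Proof. by apply: measurable_funB => //; exact: measurable_coordinate. Qed.

Lemma integrable_centered_coordinate i : P.-integrable setT (EFin \o H i).
Proof.
have ic : P.-integrable setT (EFin \o cst (fine 'E_P[coordinate h i])).
  exact: finite_measure_integrable_cst.
exact: (integrableB measurableT (ih i) ic).
Qed.

Lemma integral_centered_coordinate i : \int[P]_w (H i w)%:E = 0.
Proof.
have ic : P.-integrable setT (EFin \o cst (fine 'E_P[coordinate h i])).
  exact: finite_measure_integrable_cst.
apply/(eq_integral_EFinP measurableT (ih i) ic).
transitivity ((fine 'E_P[coordinate h i])%:E * P setT).
  rewrite probability_setT mule1 unlock fineK //; exact: integrable_fin_num (ih i).
by rewrite (integral_cst P measurableT (fine 'E_P[coordinate h i])%:E).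
Qed.

(** By [P_others], [1_A - P(A)] integrates to zero over every event of coordinate [i]. Pulling out
    [H i], a function of that coordinate, equates the integral of [1_A * H i] with [P(A)] times the
    mean of [H i], which is zero. *)
Let integral_others i A : others i A -> \int[P]_(w in A) (H i w)%:E = 0.
Proof.
move=> oA; have mA := others_measurable oA.
have iA : P.-integrable setT (EFin \o (\1_A : T -> R)) by exact: integrable_indic.
have ic : P.-integrable setT (EFin \o cst (fine (P A))).
  exact: finite_measure_integrable_cst.
pose zeta w : R := (\1_A w - fine (P A))%R.
have iz : P.-integrable setT (EFin \o zeta) by exact: (integrableB measurableT iA ic).
have i0 : P.-integrable setT (EFin \o (cst 0%R : T -> R)).
  exact: finite_measure_integrable_cst.
pose z t : R := (t - fine 'E_P[coordinate h i])%R.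
have mz : measurable_fun setT z by exact: measurable_funB.
have iAH : P.-integrable setT (fun w => (\1_A w * H i w)%:E).
  apply: integrable_boundedM (integrable_centered_coordinate i) => //.
  by move=> w; exact: normr_indic_le1.
have icH : P.-integrable setT (fun w => (fine (P A) * H i w)%:E).
  exact: integrableZl (integrable_centered_coordinate i).
have izz : P.-integrable setT (fun w => (z (coordinate h i w) * zeta w)%:E).
  apply: eq_integrable (integrableB measurableT iAH icH) => // w _ /=.
  by rewrite -EFinB; congr EFin; rewrite /z /zeta /H; ring.
have zeta0 B0 : measurable B0 -> \int[P]_(w in coordinate h i @^-1` B0) (zeta w)%:E =
    \int[P]_(w in coordinate h i @^-1` B0) (cst 0%R w)%:E.
  move=> mB0; have mhB0 := mhB i mB0; rewrite integral0.
  apply/eq_integral_EFinP; [by []|by apply: integrableS iA|by apply: integrableS ic|].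
  transitivity (P A * P (coordinate h i @^-1` B0)).
    by rewrite -P_others //; exact: integral_indic.
  transitivity ((fine (P A))%:E * P (coordinate h i @^-1` B0)).
    by rewrite fineK //; exact: fin_num_measure.
  by rewrite (integral_cst P mhB0 (fine (P A))%:E).
have [_] := @integrable_pull_out d T R P _ _ _ (measurable_coordinate i) zeta
  (cst 0%R) (cst 0%R) z iz i0 (measurable_cst _) (fun=> erefl) zeta0 mz izz.
rewrite [RHS]integral0_eq => [Hz|w _]; last by rewrite mulr0.
rewrite integral_indicM.
have : \int[P]_w (\1_A w * H i w)%:E = \int[P]_w (fine (P A) * H i w)%:E.
  apply/eq_integral_EFinP => //; rewrite -Hz; apply: eq_integral => w _.
  by congr EFin; rewrite /z /zeta /H; ring.
move=> ->; under eq_integral do rewrite EFinM.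
rewrite integralZl //; last exact: integrable_centered_coordinate.
by rewrite integral_centered_coordinate mule0.
Qed.

(** Given the other coordinates [H i] has conditional mean 0, and the product over [s] is measurable
    for them. Taking [s] to be a sequence allows repeated factors. *)
Lemma integral_centered_coordinate_prod i (s : seq 'I_k) : i \notin s ->
  P.-integrable setT (fun w => (\prod_(j <- s) H j w * H i w)%:E) ->
  \int[P]_w (\prod_(j <- s) H j w * H i w)%:E = 0.
Proof.
move=> si iZ.
have i0 : P.-integrable setT (EFin \o (cst 0%R : T -> R)).
  exact: finite_measure_integrable_cst.
have mZ : measurable_fun setT ((fun w => \prod_(j <- s) H j w)%R : Tothers i -> R).
  apply: measurable_prod => j js; apply: measurable_funB => //.
  by apply: mcoord_others; apply: contraNneq si => <-.
have H0 A : others i A -> \int[P]_(w in A) (H i w)%:E = \int[P]_(w in A) (cst 0%R w)%:E.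
  by move=> oA; rewrite integral0 integral_others.
have [_ ->] := integrable_pull_out_g_sigma_algebra (@others_setI i) (others_setT i)
  (@others_measurable i) (integrable_centered_coordinate i) i0 (measurable_cst _) H0 mZ iZ.
by rewrite integral0_eq // => w _; rewrite mulr0.
Qed.

End independence.

(** * [Pairs] and [Triples] in terms of [O] and the factor moments *)

Section moments.
Context d0 (T : measurableType d0) (R : realType) (P : probability T R).

Definition mean (f : T -> R) : R := fine (\int[P]_w (f w)%:E)%E.

Lemma expectation_mean (f : T -> R) : fine 'E_P[f] = mean f.
Proof. by rewrite unlock. Qed.

(** Integrability is returned with the value so that the lemma applies to its own output in iterated
    sums. *)
Lemma mean_sum (I : Type) (s : seq I) (c : I -> R) (F : I -> T -> R) :
  (forall i, P.-integrable setT (EFin \o F i)) ->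
  P.-integrable setT (EFin \o (fun w => \sum_(i <- s) c i * F i w)) /\
  mean (fun w => \sum_(i <- s) c i * F i w) = \sum_(i <- s) c i * mean (F i).
Proof.
move=> iF.
have icF i : P.-integrable setT (fun w => (c i * F i w)%:E).
  exact: (integrableZl measurableT (c i) (iF i)).
have iS := integrable_sum measurableT s (P := xpredT) (fun i _ => icF i).
split; first by apply: eq_integrable iS => // w _; rewrite /= sumEFin.
rewrite /mean; under eq_integral do rewrite -sumEFin.
rewrite integral_sum // -sum_fine; last by move=> i _; exact: integrable_fin_num (icF i).
apply: eq_bigr => i _; under eq_integral do rewrite EFinM.
by rewrite (integralZl measurableT (iF i)) fineM //; exact: integrable_fin_num (iF i).
Qed.

Lemma eq_mean (f g : T -> R) : f =1 g -> mean f = mean g.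
Proof. by move=> /funext ->. Qed.

Context (k d : nat) (h : {RV P >-> borel_cV R k}).
Variables (x : nat -> {RV P >-> borel_cV R d}) (O : 'M[R]_(d, k)).
Hypothesis model : exchangeable_factor_model h x O.

Local Notation H := (centered_coordinate h).
Let ih := factors_integrable model.
Let ind := factors_independent model.

Definition third_moment i : R := fine 'E_P[centered_power P (coordinate h i) 3].

Let iH2 i : P.-integrable setT (EFin \o (fun w => H i w ^+ 2)).
Proof. exact: (factors_moments model i (p := 2%N)). Qed.

Let iH3 i : P.-integrable setT (EFin \o (fun w => H i w ^+ 3)).
Proof. exact: (factors_moments model i (p := 3%N)). Qed.

Let mH := measurable_centered_coordinate h.

Lemma integrable_centered_coordinate2 i j :
  P.-integrable setT (EFin \o (fun w => H i w * H j w)).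
Proof.
apply: (@le_integrable_EFin _ _ _ _ _ (fun w => H i w ^+ 2 + H j w ^+ 2)).
- by apply: measurable_funM; exact: mH.
- move=> w; rewrite [leRHS]ger0_norm ?addr_ge0 ?sqr_ge0 // ler_norml.
  by apply/andP; split; nra.
- exact: (integrableD measurableT (iH2 i) (iH2 j)).
Qed.

(** A weak form of the arithmetic-geometric mean inequality: [(p + q + r)] times the sum of the
    squared differences is [2 (p^3 + q^3 + r^3) - 6 p q r]. It bounds mixed products by the third
    moments of single factors. *)
Let abs_mul3_le (a b c : R) : `|a * b * c| <= `|a ^+ 3| + `|b ^+ 3| + `|c ^+ 3|.
Proof.
rewrite !normrX !normrM; set p := `|a|; set q := `|b|; set r := `|c|.
have p0 : 0 <= p by exact: normr_ge0.
have q0 : 0 <= q by exact: normr_ge0.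
have r0 : 0 <= r by exact: normr_ge0.
have : 0 <= (p + q + r) * ((p - q) ^+ 2 + (q - r) ^+ 2 + (p - r) ^+ 2).
  by rewrite mulr_ge0 // ?addr_ge0 // ?sqr_ge0.
have : 0 <= p * q * r by rewrite !mulr_ge0.
by lra.
Qed.

Lemma integrable_centered_coordinate3 i j l :
  P.-integrable setT (EFin \o (fun w => H i w * H j w * H l w)).
Proof.
apply: (@le_integrable_EFin _ _ _ _ _
  (fun w => `|H i w ^+ 3| + `|H j w ^+ 3| + `|H l w ^+ 3|)).
- by apply: measurable_funM; [apply: measurable_funM|]; exact: mH.
- by move=> w; rewrite [leRHS]ger0_norm ?addr_ge0.
- exact: (integrableD measurableT (integrableD measurableT
    (integrable_abse (iH3 i)) (integrable_abse (iH3 j))) (integrable_abse (iH3 l))).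
Qed.

Lemma mean_centered_coordinate2 i j :
  mean (fun w => H i w * H j w) = (i == j)%:R * stddev P (coordinate h i) ^+ 2.
Proof.
have [<-|ij] := eqVneq i j.
  rewrite mul1r /stddev sqr_sqrtr; last first.
    by have := factors_stddev_gt0 model i; rewrite /stddev sqrtr_gt0 => /ltW.
  by rewrite /variance covariance.unlock expectation_mean; apply: eq_mean.
rewrite mul0r -[RHS]/(fine 0%E)
  -(integral_centered_coordinate_prod ind ih (i := i) (s := [:: j])).
- by congr fine; apply: eq_integral => w _; rewrite big_seq1 mulrC.
- by rewrite inE.
- apply: eq_integrable (integrable_centered_coordinate2 i j) => // w _ /=.
  by rewrite big_seq1 mulrC.
Qed.

(** Unless the three indices coincide, one of them differs from both others, and its centred factor
    makes the mean vanish. *)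
Lemma mean_centered_coordinate3 i j l :
  mean (fun w => H i w * H j w * H l w) = ((i == j) && (i == l))%:R * third_moment i.
Proof.
have zero (a b c : 'I_k) : a != b -> a != c -> mean (fun w => H b w * H c w * H a w) = 0.
  move=> ab ac.
  have E w : H b w * H c w * H a w = \prod_(t <- [:: b; c]) H t w * H a w.
    by rewrite big_cons big_seq1.
  rewrite (eq_mean E) /mean (integral_centered_coordinate_prod ind ih) //.
    by rewrite !inE negb_or ab.
  by apply: eq_integrable (integrable_centered_coordinate3 b c a) => // w _ /=; rewrite -E.
have [<-|ij] := eqVneq i j; last first.
  rewrite mul0r; have [<-|il] := eqVneq i l.
    by rewrite -[RHS](zero j i i) 1?eq_sym //; apply: eq_mean => w; ring.
  by rewrite -[RHS](zero i j l) //; apply: eq_mean => w; ring.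
have [<-|il] /= := eqVneq i l; last first.
  by rewrite mul0r -[RHS](zero l i i) 1?eq_sym.
rewrite mul1r /third_moment expectation_mean; apply: eq_mean => w.
by rewrite /centered_power -/(H i w); ring.
Qed.

(** [mean_x] is taken from view 0, yet it centres every view: all have conditional mean [O h], and
    integrating this over the whole space gives [mean_x]. *)
Lemma cond_mean_centered v a :
  is_cond_expectation P h (fun w => centered_x x v w a 0)
    (fun w => \sum_i O a i * H i w).
Proof.
have mh : measurable_fun setT h := measurable_funP h.
have cm := views_cond_mean model.
have mean_a : mean_x x a 0 = \sum_i O a i * fine 'E_P[coordinate h i].
  rewrite mxE expectation_mean /mean.
  have [_ _ _ /(_ _ measurableT)] := cm 0%N a; rewrite preimage_setT => ->.
  have -> : (fun w => ((O *m (h w : 'cV[R]_k)) a 0)%:E) =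
      (fun w => (\sum_i O a i * coordinate h i w)%:E).
    by apply/funext => w; rewrite mxE.
  rewrite -/(mean _) (mean_sum _ _ ih).2.
  by apply: eq_bigr => i _; rewrite expectation_mean.
have := cond_expectationD mh (cm v a) (cond_expectation_cst P h (- mean_x x a 0)).
congr (is_cond_expectation P h _ _); apply/funext => w /=.
  by rewrite !mxE.
rewrite mean_a !mxE -sumrN -big_split /=; apply: eq_bigr => i _.
by rewrite /centered_coordinate mulrBr.
Qed.

Let mh : measurable_fun setT h := measurable_funP h.
Let mx v : measurable_fun setT (x v) := measurable_funP (x v).

Let measurable_view a : measurable_fun setT
  ((fun u : 'cV[R]_d => u a 0 - mean_x x a 0) : borel_cV R d -> R).
Proof. by apply: measurable_funB => //; exact: measurable_coord. Qed.

Lemma mulmx_diag_tr n m (A : 'M[R]_(n, m)) (D : 'I_m -> R) a b :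
  (A *m diag_mx (\row_i D i) *m A^T) a b = \sum_i A a i * (A b i * D i).
Proof.
rewrite mxE; apply: eq_bigr => i _; rewrite mul_mx_diag !mxE; ring.
Qed.

Lemma PairsE :
  Pairs x = O *m diag_mx (\row_i (stddev P (coordinate h i) ^+ 2)) *m O^T.
Proof.
apply/matrixP => a b; rewrite mulmx_diag_tr mxE expectation_mean.
(* View 0 carries the row index [a]. Every later view gets [b], but the product below stops at view
   1. *)
pose c (v : nat) := if v is 0%N then a else b.
pose f v : 'cV[R]_d -> R := fun u => u (c v) 0 - mean_x x (c v) 0.
pose Y v : T -> R := fun w => \sum_i O (c v) i * H i w.
have ceY v : is_cond_expectation P h (f v \o x v) (Y v).
  have := cond_mean_centered v (c v).
  by congr (is_cond_expectation P h _ _); apply/funext => w; rewrite /f /= !mxE.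
have fE w : pairs_integrand x w a b = \prod_(v < 2) f v (x v w).
  by rewrite !big_ord_recl big_ord0 mulr1 /f /= !mxE big_ord1 !mxE.
have iF : P.-integrable setT (fun w => (\prod_(v < 2) f v (x v w))%:E).
  by apply: eq_integrable (pairs_integrable model a b) => // w _; rewrite fE.
have [_ eF] := integral_cond_independent_prod mh mx (views_cond_independent model)
  (fun v => measurable_view (c v)) ceY iF.
rewrite (eq_mean fE) /mean eF -/(mean _).
have YE w : \prod_(v < 2) Y v w = \sum_i O a i * \sum_j O b j * (H i w * H j w).
  rewrite !big_ord_recl big_ord0 mulr1 /Y /= mulr_suml; apply: eq_bigr => i _.
  by rewrite -mulrA mulr_sumr; congr (_ * _); apply: eq_bigr => j _; rewrite mulrCA.
have iS i := mean_sum (index_enum 'I_k) (O b) (integrable_centered_coordinate2 i).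
rewrite (eq_mean YE) (mean_sum _ _ (fun i => (iS i).1)).2.
apply: eq_bigr => i _; rewrite (iS i).2; congr (_ * _).
under eq_bigr do rewrite mean_centered_coordinate2.
rewrite (bigD1 i) //= eqxx mul1r big1 ?addr0 // => j ji.
by rewrite eq_sym (negbTE ji) mul0r mulr0.
Qed.

Lemma TriplesE (eta : 'cV[R]_d) :
  Triples x eta = O *m diag_mx (\row_i (third_moment i * (O^T *m eta) i 0)) *m O^T.
Proof.
apply/matrixP => a b; rewrite mulmx_diag_tr mxE expectation_mean.
(* The third factor is the scalar product of [eta] with a centred view; it serves as default beyond
   view 2, where the product stops. Its conditional mean combines the [H l] with the entries of
   [O^T *m eta] as coefficients. *)
pose f v : 'cV[R]_d -> R := match v with
  | 0%N => fun u => u a 0 - mean_x x a 0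
  | 1%N => fun u => u b 0 - mean_x x b 0
  | _ => fun u => \sum_c eta c 0 * (u c 0 - mean_x x c 0) end.
pose Y v : T -> R := match v with
  | 0%N => fun w => \sum_i O a i * H i w
  | 1%N => fun w => \sum_i O b i * H i w
  | _ => fun w => \sum_c eta c 0 * \sum_i O c i * H i w end.
have ce v c : is_cond_expectation P h (fun w => (x v w : 'cV[R]_d) c 0 - mean_x x c 0)
    (fun w => \sum_i O c i * H i w).
  have := cond_mean_centered v c.
  by congr (is_cond_expectation P h _ _); apply/funext => w; rewrite /= !mxE.
have ceY v : is_cond_expectation P h (f v \o x v) (Y v).
  case: v => [|[|v]]; [exact: ce|exact: ce|].
  by apply: (cond_expectation_sum mh) => c; apply: (cond_expectationZ mh); exact: ce.
have mf v : measurable_fun setT (f v : borel_cV R d -> R).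
  case: v => [|[|v]]; [exact: measurable_view|exact: measurable_view|].
  by apply: measurable_sum => c; apply: measurable_funM => //; exact: measurable_view.
have fE w : triples_integrand x eta w a b = \prod_(v < 3) f v (x v w).
  rewrite !big_ord_recl big_ord0 mulr1 /f /= !mxE big_ord1 !mxE [LHS]mulrC -mulrA.
  congr (_ * (_ * _)); rewrite /dotv; by apply: eq_bigr => c _; rewrite !mxE.
have iF : P.-integrable setT (fun w => (\prod_(v < 3) f v (x v w))%:E).
  by apply: eq_integrable (triples_integrable model eta a b) => // w _; rewrite fE.
have [_ eF] := integral_cond_independent_prod mh mx (views_cond_independent model)
  mf ceY iF.
rewrite (eq_mean fE) /mean eF -/(mean _).
pose g l := (O^T *m eta) l 0.
have YE w : \prod_(v < 3) Y v w =
    \sum_i O a i * \sum_j O b j * \sum_l g l * (H i w * H j w * H l w).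
  have -> : \prod_(v < 3) Y v w = Y 0%N w * (Y 1%N w * \sum_l g l * H l w).
    rewrite !big_ord_recl big_ord0 mulr1 /Y /=; congr (_ * (_ * _)).
    under eq_bigr do rewrite mulr_sumr.
    rewrite exchange_big /=; apply: eq_bigr => l _; rewrite /g mxE mulr_suml.
    by apply: eq_bigr => c _; rewrite mxE mulrA (mulrC (eta c 0)).
  rewrite mulr_suml; apply: eq_bigr => i _; rewrite -mulrA; congr (_ * _).
  rewrite mulr_suml mulr_sumr; apply: eq_bigr => j _.
  rewrite mulrCA -mulrA; congr (_ * _); rewrite !mulr_sumr.
  by apply: eq_bigr => l _; ring.
have iS i j := mean_sum (index_enum 'I_k) g (integrable_centered_coordinate3 i j).
have iS2 i := mean_sum (index_enum 'I_k) (O b) (fun j => (iS i j).1).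
rewrite (eq_mean YE) (mean_sum _ _ (fun i => (iS2 i).1)).2.
apply: eq_bigr => i _; rewrite (iS2 i).2; congr (_ * _).
rewrite (bigD1 i) //= big1 ?addr0 => [|j ji]; last first.
  rewrite (iS i j).2 big1 ?mulr0 // => l _; rewrite mean_centered_coordinate3.
  by rewrite eq_sym (negbTE ji) mul0r mulr0.
congr (_ * _); rewrite (iS i i).2 (bigD1 i) //= big1 ?addr0 => [|l li].
  by rewrite mean_centered_coordinate3 eqxx mul1r mulrC.
by rewrite mean_centered_coordinate3 eqxx eq_sym (negbTE li) mul0r mulr0.
Qed.

End moments.

(** * Singular value decompositions of an orthogonally diagonalized matrix *)

Section svd.
Variables (R : realType) (n : nat).
Implicit Types (M A B N Q : 'M[R]_n) (s : 'rV[R]_n).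

Lemma orthogonal_mx_row_norm N i : N *m N^T = 1%:M -> \sum_j N i j ^+ 2 = 1.
Proof.
move=> /matrixP /(_ i i); rewrite !mxE eqxx; apply: etrans.
by apply: eq_bigr => j _; rewrite mxE expr2.
Qed.

Lemma orthogonal_mx_row_neq0 N i : N *m N^T = 1%:M -> exists j, N i j != 0.
Proof.
move=> /(orthogonal_mx_row_norm i) N1; apply/existsP; apply: contraT.
rewrite negb_exists => /forallP N0; move: N1; rewrite big1 => [/eqP|j _].
  by rewrite eq_sym oner_eq0.
by have := N0 j; rewrite negbK => /eqP ->; rewrite expr0n.
Qed.

(** A boolean, so that [pick] can search for such a column. *)
Definition unique_value s j := [forall j', (s 0 j' == s 0 j) ==> (j' == j)].

Lemma unique_valueP s j :
  reflect (forall j', s 0 j' = s 0 j -> j' = j) (unique_value s j).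
Proof.
apply: (iffP forallP) => [H j' /eqP sj|H j'].
  by apply/eqP; have := H j'; rewrite sj.
by apply/implyP => /eqP /H ->.
Qed.

Variables (Q M A B : 'M[R]_n) (lam : 'I_n -> R) (s : 'rV[R]_n).
Hypotheses (QQ : Q *m Q^T = 1%:M) (ME : M = Q *m diag_mx (\row_i lam i) *m Q^T).

(** The signs [e i] of the eigenvalues are absorbed into the right factor, which leaves [|lam i|] as
    singular values. A zero eigenvalue gets sign 1, so that the right factor remains orthogonal. *)
Lemma is_svd_exists : exists A' s' B', is_svd M A' s' B'.
Proof.
pose e i : R := if lam i < 0 then -1 else 1.
have QtQ := mulmx1C QQ.
exists Q, (\row_i `|lam i|), (Q *m diag_mx (\row_i e i)); split => //.
- rewrite trmx_mul tr_diag_mx mulmxA -(mulmxA (diag_mx _)) QtQ mulmx1 mulmx_diag.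
  apply/matrixP => i j; rewrite !mxE; case: eqVneq => //= _.
  by rewrite /e; case: ifP; rewrite ?mulrNN mulr1.
- by move=> j; rewrite mxE.
- rewrite trmx_mul tr_diag_mx !mulmxA -(mulmxA Q) mulmx_diag ME.
  congr (_ *m diag_mx _ *m _); apply/rowP => i; rewrite !mxE /e.
  by case: ltrP => [/ltr0_norm|/ger0_norm] ->; rewrite ?mulrNN mulr1.
Qed.

Hypothesis svdM : is_svd M A s B.

(** Coordinates of the left singular vectors in the eigenbasis [Q]. *)
Let N := Q^T *m A.

Let NtN : N^T *m N = 1%:M.
Proof.
case: svdM => AA _ _ _.
by rewrite /N trmx_mul trmxK mulmxA -(mulmxA A^T) QQ mulmx1.
Qed.

Let NNt : N *m N^T = 1%:M. Proof. exact: mulmx1C. Qed.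

(* M M^T = A diag(s^2) A^T = Q diag(lam^2) Q^T *)
Let N_eq i j : N i j != 0 -> s 0 j ^+ 2 = lam i ^+ 2.
Proof.
case: svdM => AA BB s0 MS Nij.
have E : N *m diag_mx s *m diag_mx s =
    diag_mx (\row_i lam i) *m diag_mx (\row_i lam i) *m N.
  have MM1 : M *m M^T = A *m diag_mx s *m diag_mx s *m A^T.
    by rewrite MS !trmx_mul trmxK tr_diag_mx !mulmxA -(mulmxA (A *m diag_mx s)) BB mulmx1.
  have MM2 : M *m M^T = Q *m diag_mx (\row_i lam i) *m diag_mx (\row_i lam i) *m Q^T.
    by rewrite ME !trmx_mul trmxK tr_diag_mx !mulmxA -(mulmxA (Q *m _))
      (mulmx1C QQ) mulmx1.
  have : Q^T *m (M *m M^T) *m A = Q^T *m (M *m M^T) *m A by [].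
  rewrite {1}MM1 MM2 !mulmxA (mulmx1C QQ) mul1mx.
  by rewrite -(mulmxA _ A^T A) AA mulmx1 /N.
move: (N) Nij E => N' Nij /matrixP/(_ i j).
rewrite -mulmxA !mulmx_diag mul_mx_diag mul_diag_mx !mxE -!expr2 [RHS]mulrC => E.
exact: (mulfI Nij E).
Qed.

(** Along row [i] the nonzero entries have singular values with equal squares, hence equal since
    nonnegative, and [s 0 j] occurs only once. *)
Let N_unique i j j' : unique_value s j -> N i j != 0 -> N i j' != 0 -> j' = j.
Proof.
case: svdM => _ _ s0 _ /unique_valueP uj Nij Nij'; apply: uj; apply/eqP.
by rewrite -(eqrXn2 (n := 2)) // (N_eq Nij) (N_eq Nij').
Qed.

Let N_sign i j : unique_value s j -> N i j != 0 -> N i j = 1 \/ N i j = -1.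
Proof.
move=> uj Nij; have := orthogonal_mx_row_norm i NNt.
rewrite (bigD1 j) //= big1 ?addr0 => [/eqP|j' jj'].
  by rewrite sqrf_eq1 => /orP[/eqP|/eqP] ->; [left|right].
apply/eqP; rewrite sqrf_eq0; apply: contraNT jj' => Nij'.
by rewrite (N_unique uj Nij Nij').
Qed.

(** The entry [N i j], of absolute value 1, exhausts the unit norm of column [j] of [N], so column
    [j] of [A] has no other component in the basis [Q]. *)
Let N_col i j : unique_value s j -> N i j != 0 -> col j A = N i j *: col i Q.
Proof.
move=> uj Nij; have AE : A = Q *m N by rewrite /N mulmxA QQ mul1mx.
have N0 i' : i' != i -> N i' j = 0.
  have NT : N^T *m N^T^T = 1%:M by rewrite trmxK.
  have := orthogonal_mx_row_norm j NT.
  have N1 : N i j ^+ 2 = 1 by case: (N_sign uj Nij) => ->; rewrite ?sqrrN expr1n.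
  rewrite (bigD1 i) //= mxE N1 => /eqP; rewrite -subr_eq0 addrAC subrr add0r.
  rewrite psumr_eq0 => [/allP H ii'|l _]; last exact: sqr_ge0.
  by have := H i' (mem_index_enum _); rewrite ii' mxE sqrf_eq0 => /eqP.
have AEl l : A l j = \sum_i' Q l i' * N i' j by rewrite {1}AE mxE.
apply/colP => l; rewrite [LHS]mxE AEl [RHS]mxE [X in _ = _ * X]mxE.
rewrite (bigD1 i) //= big1 ?addr0 => [|i' ii'].
  by rewrite mulrC.
by rewrite N0 // mulr0.
Qed.

Lemma is_svd_unique_columns : exists2 e : 'I_n -> R, is_sign e &
  (forall j, unique_value s j -> exists i, col j A = e i *: col i Q) /\
  (injective (fun i => lam i ^+ 2) ->
   forall i, exists2 j, unique_value s j & col j A = e i *: col i Q).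
Proof.
(* By [N_unique] at most one column with a simple singular value meets row [i], so its entry defines
   a sign depending on [i] alone. Rows met by none get the default 1. *)
pose e i := if [pick j | unique_value s j && (N i j != 0)] is Some j then N i j else 1.
have eE i j : unique_value s j -> N i j != 0 -> e i = N i j.
  move=> uj Nij; rewrite /e; case: pickP => [j' /andP[uj' Nij']|/(_ j)].
    by rewrite (N_unique uj Nij Nij').
  by rewrite uj Nij.
have NT : N^T *m N^T^T = 1%:M by rewrite trmxK.
have colN j : exists i, N i j != 0.
  by have [i] := orthogonal_mx_row_neq0 j NT; rewrite mxE; exists i.
exists e; [|split].
- move=> i; rewrite /e; case: pickP => [j /andP[uj Nij]|_]; last by left.
  exact: N_sign uj Nij.
- move=> j uj; have [i Nij] := colN j; exists i.
  by rewrite (eE i j) //; exact: N_col.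
(* When the squares are distinct, every column of [N] whose singular value is [s 0 j] is supported
   on row [i]. Two such columns could not be orthogonal, so that value is simple. *)
- move=> lamI i; have [j Nij] := orthogonal_mx_row_neq0 i NNt.
  have supp i' j' : s 0 j' = s 0 j -> N i' j' != 0 -> i' = i.
    move=> sj' /N_eq; rewrite sj' => E; apply: lamI => /=.
    by rewrite -E (N_eq Nij).
  have uj : unique_value s j.
    apply/unique_valueP => j' sj'; apply/eqP; apply: contraT => jj'.
    have /matrixP/(_ j' j) := NtN; rewrite !mxE (negbTE jj') (bigD1 i) //= big1.
      have [i' Nij'] := colN j'; have E := supp _ _ sj' Nij'; rewrite E in Nij'.
      by rewrite addr0 mxE => /eqP; rewrite mulf_eq0 (negbTE Nij) (negbTE Nij').
    move=> i' ii'; rewrite mxE; apply/eqP; rewrite mulf_eq0; apply/orP; right.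
    by apply: contraNT ii' => Ni'j; rewrite (supp i' j).
  by exists j => //; rewrite (eE i j) //; exact: N_col.
Qed.

End svd.

(** * Whitening and the orthogonal matrix it produces *)

Section whitening.
Variables (R : realType) (k d : nat).

(** With [v = u *m W^T], the hypothesis gives [v *m v^T = 0], a vanishing sum of squares. *)
Lemma mulmx_tr_eq0 m n (W : 'M[R]_(m, n)) (u : 'rV[R]_n) :
  u *m (W^T *m W) = 0 -> u *m W^T = 0.
Proof.
move=> H; have : (u *m W^T) *m (u *m W^T)^T = 0.
  by rewrite trmx_mul trmxK !mulmxA -(mulmxA u) H mul0mx.
move=> /matrixP /(_ 0 0); rewrite !mxE => /eqP; rewrite psumr_eq0 => [/allP H0|i _].
  apply/rowP => i; have := H0 i (mem_index_enum _).
  by rewrite [(_^T) _ _]mxE -expr2 sqrf_eq0 => /eqP ->; rewrite mxE.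
by rewrite [(_^T) _ _]mxE -expr2 sqr_ge0.
Qed.

Lemma gram_unitmx m n (W : 'M[R]_(m, n)) :
  (forall u : 'rV[R]_n, u *m W^T = 0 -> u = 0) -> W^T *m W \in unitmx.
Proof.
move=> W0; rewrite -row_free_unit -kermx_eq0; apply/rowV0P => u /sub_kermxP.
by move=> /mulmx_tr_eq0 /W0.
Qed.

Variables (O : 'M[R]_(d, k)) (sigma : 'I_k -> R).
Hypotheses (rO : \rank O = k) (sigma_gt0 : forall i, 0 < sigma i).

Let S := diag_mx (\row_i sigma i).
Let Si := diag_mx (\row_i (sigma i)^-1).

Let SSi : S *m Si = 1%:M.
Proof.
rewrite mulmx_diag; apply/matrixP => i j; rewrite !mxE mulfV //.
by rewrite gt_eqF.
Qed.

Let S2 : diag_mx (\row_i (sigma i ^+ 2)) = S *m S.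
Proof. by rewrite mulmx_diag; congr diag_mx; apply/rowP => i; rewrite !mxE expr2. Qed.

Let GO : O^T *m O \in unitmx.
Proof.
have rf : row_free O^T by rewrite /row_free mxrank_tr rO.
by apply: gram_unitmx => u uO; apply: (row_free_inj rf); rewrite /= uO mul0mx.
Qed.

Let Prs := O *m diag_mx (\row_i (sigma i ^+ 2)) *m O^T.

Let PrsT : Prs^T = Prs.
Proof. by rewrite /Prs !trmx_mul trmxK tr_diag_mx mulmxA. Qed.

Lemma eca_whitening_exists : exists (U : 'M[R]_(d, k)) (V : 'M[R]_k),
  eca_whitening Prs U V.
Proof.
have SiS := mulmx1C SSi.
(* For [U = O] and [G = O^T *m O] the matrix to normalize is [G S^2 G], which [V = G^-1 S^-1]
   reduces to the identity. *)
exists O, (invmx (O^T *m O) *m Si); split.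
  apply/andP; rewrite PrsT /Prs S2; split; last exact: submxMl.
  apply/submxP; exists (Si *m Si *m invmx (O^T *m O) *m O^T).
  rewrite !mulmxA -(mulmxA _ O^T O) (mulmxKV GO) -(mulmxA _ Si S) SiS mulmx1.
  by rewrite SiS mul1mx.
rewrite /Prs S2 trmx_mul tr_diag_mx trmx_inv trmx_mul trmxK.
have -> : O^T *m (O *m (S *m S) *m O^T) *m O = O^T *m O *m S *m S *m (O^T *m O).
  by rewrite !mulmxA.
move: (O^T *m O) GO => G uG.
by rewrite !mulmxA (mulmxKV uG) (mulmxK uG) SiS mul1mx SSi.
Qed.

Variables (U : 'M[R]_(d, k)) (V : 'M[R]_k).
Hypothesis UV : eca_whitening Prs U V.

Let W := U *m V.

Definition whitened_mixing : 'M[R]_k := (U *m V)^T *m O *m diag_mx (\row_i sigma i).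

Local Notation Q := whitened_mixing.

(** Since [Prs] is [O *m S] times its own transpose, this is the whitening condition itself. *)
Lemma whitened_mixing_orthogonal : Q *m Q^T = 1%:M.
Proof.
case: UV => _ <-; rewrite /Q /Prs S2 !trmx_mul tr_diag_mx trmxK !mulmxA.
by rewrite trmxK.
Qed.

Let GW : W^T *m W \in unitmx.
Proof.
apply: gram_unitmx => u uW; rewrite -[u]mulmx1 -whitened_mixing_orthogonal /Q.
by rewrite !mulmxA uW !mul0mx.
Qed.

(** [O = Prs O (O^T O)^-1 S^-2] puts the columns of [O] in the range of [Prs], hence in that of [U],
    which is the range of [W] because [V] is invertible. *)
Let mixing_range : exists K : 'M[R]_k, O = W *m K.
Proof.
case: UV => /andP[_ /submxP[C PC]] VV.
have PE : Prs = U *m C^T by rewrite -[LHS]trmxK PC trmx_mul trmxK.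
have Vu : V \in unitmx by case: (mulmx1_unit VV).
exists (invmx V *m C^T *m O *m invmx (O^T *m O) *m (Si *m Si)).
rewrite /W !mulmxA (mulmxK Vu) -PE /Prs S2 !mulmxA -(mulmxA _ O^T O) (mulmxK GO).
by rewrite -(mulmxA _ S Si) SSi mulmx1 -mulmxA SSi mulmx1.
Qed.

(** The transposed pseudo-inverse times [W^T] is the orthogonal projection onto the range of [W],
    and by [mixing_range] it fixes the columns of [O]. *)
Lemma pinv_whitened_mixing i : (Defs.pinv W)^T *m col i Q = sigma i *: col i O.
Proof.
have pinvO : (Defs.pinv W)^T *m (W^T *m O) = O.
  have [K ->] := mixing_range; move: (W) GW => W' uW'.
  rewrite /Defs.pinv trmx_mul trmxK trmx_inv trmx_mul trmxK !mulmxA.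
  by rewrite -(mulmxA _ W'^T W') (mulmxKV uW').
rewrite [col i Q]colE /Q !mulmxA -(mulmxA _ _ O) pinvO -colE; apply/colP => a.
by rewrite !mxE (bigD1 i) //= big1 ?addr0 => [|j ji];
  rewrite !mxE ?eqxx ?(negbTE ji) ?mulr0 // mulrC.
Qed.

(** Each of the three occurrences of [W] meets [O] in [W^T *m O = Q *m Si] or its transpose. The
    resulting three factors [1 / sigma i] turn a third moment [t i] into a skewness. *)
Lemma whitened_triples (t : 'I_k -> R) (theta : 'cV[R]_k) :
  W^T *m (O *m diag_mx (\row_i (t i * (O^T *m (W *m theta)) i 0)) *m O^T) *m W =
  Q *m diag_mx (\row_i (t i / sigma i ^+ 3 * (Q^T *m theta) i 0)) *m Q^T.
Proof.
have WO : W^T *m O = Q *m Si by rewrite /Q -mulmxA SSi mulmx1.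
have OW : O^T *m W = Si *m Q^T.
  by rewrite -[LHS]trmxK trmx_mul trmxK WO trmx_mul tr_diag_mx.
move: (W) (Q) WO OW => W' Q' WO OW.
rewrite !mulmxA WO -(mulmxA _ O^T W') OW !mulmxA; congr (_ *m _).
rewrite -!(mulmxA Q'); congr (_ *m _); rewrite !mulmx_diag; congr diag_mx.
apply/rowP => i; rewrite -(mulmxA Si) mul_diag_mx !mxE.
have := sigma_gt0 i; move: (sigma i) => c c0.
have cn : c != 0 by rewrite gt_eqF.
by field.
Qed.

End whitening.

(** * Scalar products, reflections and the moment curve *)

Section dotv.
Variables (R : realType) (n : nat).
Implicit Types u v : 'cV[R]_n.

Lemma dotv_mxE u v : dotv u v = (u^T *m v) 0 0.
Proof. by rewrite /dotv mxE; apply: eq_bigr => i _; rewrite mxE. Qed.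

Lemma dotv_mulmx (G : 'M[R]_n) u v : dotv u (G *m v) = dotv (G^T *m u) v.
Proof. by rewrite !dotv_mxE trmx_mul trmxK mulmxA. Qed.

Lemma dotvZl c u v : dotv (c *: u) v = c * dotv u v.
Proof. by rewrite /dotv mulr_sumr; apply: eq_bigr => i _; rewrite mxE mulrA. Qed.

Lemma dotvDl u u' v : dotv (u + u') v = dotv u v + dotv u' v.
Proof. by rewrite /dotv -big_split; apply: eq_bigr => i _; rewrite mxE mulrDl. Qed.

Lemma dotvC u v : dotv u v = dotv v u.
Proof. by apply: eq_bigr => i _; rewrite mulrC. Qed.

Lemma dotv_self_gt0 u : u != 0 -> 0 < dotv u u.
Proof.
move=> u0; rewrite lt0r; apply/andP; split; last first.
  by apply: sumr_ge0 => i _; rewrite -expr2 sqr_ge0.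
apply: contraNneq u0 => /eqP; rewrite psumr_eq0 => [/allP H|i _]; last first.
  by rewrite -expr2 sqr_ge0.
apply/eqP/colP => i; have := H i (mem_index_enum _).
by rewrite /= -expr2 sqrf_eq0 mxE => /eqP.
Qed.

Lemma measurable_dotv u : measurable_fun setT (dotv u : borel_cV R n -> R).
Proof.
apply: measurable_sum => i; apply: measurable_funM => //; exact: measurable_coord.
Qed.

(** The Householder reflection along [a - b] exchanges two vectors of equal norm. The conclusion
    mentions [G^T] because [dotv_mulmx] moves [G] across as its transpose. *)
Lemma exists_reflection (a b : 'cV[R]_n) : dotv a a = dotv b b ->
  exists2 G : 'M[R]_n, G^T *m G = 1%:M & G^T *m b = a.
Proof.
move=> ab; have [->|aneb] := eqVneq a b.
  by exists 1%:M; rewrite trmx1 mul1mx.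
have v0 : a - b != 0 by rewrite subr_eq0.
pose v := a - b; have nv : dotv v v != 0 by rewrite gt_eqF // dotv_self_gt0.
pose G := 1%:M - (2 / dotv v v) *: (v *m v^T).
have GT : G^T = G.
  by rewrite /G linearB linearZ /= trmx1 trmx_mul trmxK.
have vv : v *m v^T *m (v *m v^T) = dotv v v *: (v *m v^T).
  rewrite mulmxA -(mulmxA v v^T v) (mx11_scalar (v^T *m v)) -dotv_mxE.
  by rewrite mul_mx_scalar scalemxAl.
exists G; rewrite GT.
- rewrite /G mulmxBl mul1mx mulmxBr mulmx1 -scalemxAl -scalemxAr vv !scalerA.
  rewrite (_ : _ * dotv v v = 2 * (2 / dotv v v)); last by field.
  by rewrite -scalerA scaler_nat mulr2n; apply/matrixP => i j; rewrite !mxE; ring.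
(* Equality of the norms puts [b] at half the length of [v] on the negative side of the mirror, so
   the reflection adds exactly [v = a - b] to it. *)
- have vb : dotv v b = - (dotv v v / 2).
    have e1 : dotv v v = dotv a a - dotv a b *+ 2 + dotv b b.
      rewrite /dotv -sumrMnl -sumrB -big_split /=; apply: eq_bigr => i _.
      by rewrite !mxE; ring.
    have e2 : dotv v b = dotv a b - dotv b b.
      by rewrite /dotv -sumrB; apply: eq_bigr => i _; rewrite !mxE; ring.
    by rewrite e1 e2 ab; field.
  rewrite /G mulmxBl mul1mx -scalemxAl -mulmxA (mx11_scalar (v^T *m b)) -dotv_mxE.
  rewrite mul_mx_scalar scalerA vb (_ : _ * _ = -1); last by field.
  by rewrite scaleN1r opprK /v addrC subrK.
Qed.

Definition moment_curve (t : R) : 'cV[R]_n := \col_i t ^+ i.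

Lemma moment_curve_neq0 t : (0 < n)%N -> moment_curve t != 0.
Proof.
move=> n0; apply/eqP => /matrixP /(_ (Ordinal n0) 0); rewrite !mxE expr0 => /eqP.
by rewrite oner_eq0.
Qed.

(* A hyperplane meets the moment curve at the roots of a polynomial of degree
   less than n. *)
Lemma moment_curve_hyperplane (u : 'cV[R]_n) (ts : seq R) : u != 0 -> uniq ts ->
  (count (fun t => dotv (moment_curve t) u == 0%R) ts <= n)%N.
Proof.
move=> u0 uts; pose p : {poly R} := rVpoly u^T.
have pE t : p.[t] = dotv (moment_curve t) u.
  rewrite /p /rVpoly horner_poly /dotv; apply: eq_bigr => i _.
  by rewrite !mxE insubT //= => lt; rewrite mxE mulrC; congr (_ * u _ _); apply/val_inj.
have p0 : p != 0.
  apply: contraNneq u0 => p0; rewrite -[u]trmxK -(rVpolyK u^T) -/p p0 linear0.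
  by rewrite trmx0.
rewrite -size_filter; apply: ltnW; apply: leq_trans (size_poly _ _ : (size p <= n)%N).
apply: max_poly_roots => //; last exact: filter_uniq.
by apply/allP => t; rewrite mem_filter => /andP[/eqP H _]; rewrite /root pE H.
Qed.

End dotv.

(** * Hyperplanes are null for the uniform law on the sphere *)

Section sphere.
Local Open Scope ereal_scope.
Context d (T : measurableType d) (R : realType) (P : probability T R) (n : nat).
Variable theta : {RV P >-> borel_cV R n}.
Hypothesis unif : uniform_on_sphere theta.

Let E (a : 'cV[R]_n) : set T := [set w | dotv a (theta w) = 0%R].

Let mE a : measurable (E a).
Proof.
have -> : E a = (dotv a \o theta) @^-1` [set 0%R] by [].
have mf : measurable_fun setT (dotv a \o theta).
  exact: (measurableT_comp (measurable_dotv a) (measurable_funP theta)).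
by rewrite -[X in measurable X]setTI; apply: mf.
Qed.

(** The reflection taking [b] to [a] carries one hyperplane to the other, and the uniform law is
    invariant under it. *)
Let PE_norm a b : dotv a a = dotv b b -> P (E a) = P (E b).
Proof.
move=> /exists_reflection [G GG Gb]; have [_ /(_ G GG (dotv b @^-1` [set 0%R]))] := unif.
have mB : <<s open >> (dotv b @^-1` [set 0%R]).
  have := measurable_dotv b measurableT (@measurable_set1 R 0%R).
  by rewrite setTI.
move=> /(_ mB) <-; congr (P _); apply/seteqP.
by split => w /=; rewrite /E /= dotv_mulmx Gb.
Qed.

(* Rescaled to the norm of [a], the points of the moment curve define
   hyperplanes of equal probability, and a nonzero vector lies on at most n
   of them. *)
Lemma uniform_on_sphere_hyperplane (a : 'cV[R]_n) : a != 0%R ->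
  {ae P, forall w, dotv a (theta w) != 0%R}.
Proof.
move=> a0.
have n0 : (0 < n)%N.
  rewrite lt0n; apply: contraNneq a0 => n0; apply/eqP/colP => i.
  by have := ltn_ord i; rewrite [X in (_ < X)%N]n0.
pose m (i : nat) : 'cV[R]_n := moment_curve n i%:R.
pose c i : R := Num.sqrt (dotv a a / dotv (m i) (m i)).
have mi0 i : (0 < dotv (m i) (m i))%R by rewrite dotv_self_gt0 ?moment_curve_neq0.
have ci0 i : (0 < c i)%R by rewrite sqrtr_gt0 divr_gt0 // dotv_self_gt0.
have PEm i : P (E (m i)) = P (E a).
  have -> : E (m i) = E (c i *: m i).
    apply/seteqP; split => w; rewrite /E /= dotvZl; first by move=> ->; rewrite mulr0.
    by move=> /eqP; rewrite mulf_eq0 gt_eqF //= => /eqP.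
  apply: PE_norm; rewrite dotvZl dotvC dotvZl mulrA -expr2 sqr_sqrtr.
    by rewrite divfK // gt_eqF.
  by rewrite divr_ge0 // ltW // dotv_self_gt0.
(* The left side is the expected number of the first [N] hyperplanes containing [theta], a number at
   most [n] almost surely because [theta] has norm 1 and so is nonzero. *)
have bound N : N%:R%:E * P (E a) <= n%:R%:E.
  have -> : N%:R%:E * P (E a) = \int[P]_w (\sum_(i <- iota 0 N) (\1_(E (m i)) w)%:E).
    rewrite ge0_integral_sum //; last first.
      by move=> i; apply/measurable_EFinP; exact: measurable_indic.
    transitivity (\sum_(i <- iota 0 N) P (E a)); last first.
      by apply: eq_bigr => i _; rewrite -(PEm i) integral_indic // setIT.
    rewrite big_const_seq count_predT size_iota.
    elim: N => [|N IH]; first by rewrite mul0e.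
    by rewrite iterS -IH -{2}[P (E a)]mul1e -ge0_muleDl ?lee_fin // -EFinD nat1r.
  have -> : n%:R%:E = \int[P]_w (cst n%:R%:E w).
    transitivity (n%:R%:E * P setT); first by rewrite probability_setT mule1.
    by rewrite (integral_cst P measurableT n%:R%:E).
  apply: ae_ge0_le_integral => //.
  - by move=> w _; apply: sume_ge0 => i _; rewrite lee_fin.
  - apply: emeasurable_sum => i; apply/measurable_EFinP; exact: measurable_indic.
  - by move=> w _; rewrite lee_fin.
  have [ae1 _] := unif; apply: filterS ae1 => w t1 _.
  have t0 : (theta w : 'cV[R]_n) != 0%R.
    apply/eqP => t0; move: t1; rewrite t0 /dotv big1 => [/eqP|i _].
      by rewrite eq_sym oner_eq0.
    by rewrite mxE mul0r.
  have ur : uniq [seq (i%:R : R) | i <- iota 0 N].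
    by rewrite map_inj_uniq ?iota_uniq //; exact: mulrIn (oner_neq0 R).
  have := moment_curve_hyperplane t0 ur; rewrite count_map sumEFin lee_fin.
  rewrite -(ler_nat R); apply: le_trans; rewrite -sum1_count natr_sum.
  rewrite [leRHS]big_mkcond /=; apply: ler_sum => i _; rewrite indicE.
  case: ifPn => [_|mi]; first by case: (_ \in _).
  by rewrite memNset //= => H; move/eqP: mi; apply.
have P0 : P (E a) = 0.
  apply/eqP; rewrite eq_le measure_ge0 andbT leNgt; apply/negP => p0.
  have fp : P (E a) \is a fin_num by exact: fin_num_measure.
  have p0' : (0 < fine (P (E a)))%R by rewrite fine_gt0 // p0 ltey_eq fp.
  (* A positive probability is refuted by taking [N] larger than [n] divided by it. *)
  have := bound (Num.bound (n%:R / fine (P (E a)))).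
  rewrite -(fineK fp) -EFinM lee_fin leNgt => /negP; apply.
  by rewrite -ltr_pdivrMr //; apply: archi_boundP; rewrite divr_ge0 // ltW.
exists (E a); split => // w /= /negP; rewrite negbK => /eqP; exact.
Qed.

End sphere.

(** Two squares agree only if the values are equal or opposite, and each case places [theta] in the
    hyperplane normal to [c i Q_i - c j Q_j] or [c i Q_i + c j Q_j]. These normals are nonzero as
    the [Q_i] are orthonormal and [c i != 0]. *)
Lemma uniform_on_sphere_distinct_sqr (disp : measure_display)
    (T : measurableType disp) (R : realType) (P : probability T R) (k : nat)
    (theta : {RV P >-> borel_cV R k}) (Q : 'M[R]_k) (c : 'I_k -> R) :
  uniform_on_sphere theta -> Q *m Q^T = 1%:M -> (forall i, c i != 0) ->
  {ae P, forall w, injective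
    (fun i => (c i * (Q^T *m (theta w : 'cV[R]_k)) i 0) ^+ 2)}.
Proof.
move=> unif QQ c0.
pose a (e : R) i j : 'cV[R]_k := c i *: col i Q + (e * c j) *: col j Q.
have dot_col i (u : 'cV[R]_k) : dotv (col i Q) u = (Q^T *m u) i 0.
  by rewrite /dotv mxE; apply: eq_bigr => l _; rewrite !mxE.
have a_neq0 e i j : i != j -> a e i j != 0.
  move=> ij; apply: contraNneq (c0 i) => a0.
  have : dotv (col i Q) (a e i j) = c i.
    rewrite dotvC dotvDl !dotvZl !dot_col !colE !mulmxA (mulmx1C QQ) mul1mx !mxE.
    by rewrite !eqxx [j == i]eq_sym (negbTE ij) /= mulr1 mulr0 addr0.
  by rewrite a0 dot_col mulmx0 mxE => <-.
have ae_a e i j : {ae P, forall w, i != j -> dotv (a e i j) (theta w) != 0}.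
  have [->|ij] := eqVneq i j; first by apply: nearW.
  by have := uniform_on_sphere_hyperplane unif (a_neq0 e i j ij); apply: filterS.
(* The boolean encodes the sign in the normal; the finitely many null events are gathered into
   one. *)
have : {ae P, forall w, forall p : 'I_k * 'I_k * bool,
    p.1.1 != p.1.2 -> dotv (a (if p.2 then 1 else -1) p.1.1 p.1.2) (theta w) != 0}.
  by apply: filter_forall => -[[i j] b]; exact: ae_a.
apply: filterS => w H i j /= /eqP; rewrite eqf_sqr => eq_ij.
apply/eqP; apply: contraT => ij.
have dot_a e : dotv (a e i j) (theta w) = c i * (Q^T *m (theta w : 'cV[R]_k)) i 0
    + e * (c j * (Q^T *m (theta w : 'cV[R]_k)) j 0).
  by rewrite dotvDl !dotvZl !dot_col mulrA.
case/orP: eq_ij => /eqP E.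
- by have := H (i, j, false) ij; rewrite /= dot_a E mulN1r subrr eqxx.
- by have := H (i, j, true) ij; rewrite /= dot_a E mul1r addNr eqxx.
Qed.

(** * Soundness and exact recovery of the procedure *)

Theorem theorem4p1 (R : realType) (k d : nat) (disp : measure_display)
    (T : measurableType disp) (P : probability T R)
    (h : {RV P >-> borel_cV R k}) (x : nat -> {RV P >-> borel_cV R d})
    (O : 'M[R]_(d, k)) (hkd : (k <= d)%N)
    (hmodel : exchangeable_factor_model h x O) :
  (exists (U : 'M[R]_(d, k)) (V : 'M[R]_k), eca_whitening (Pairs x) U V) /\
  (forall (U : 'M[R]_(d, k)) (V : 'M[R]_k), eca_whitening (Pairs x) U V ->
     (forall theta : 'cV[R]_k,
        (exists Ohat, eca_output (Triples x) (U *m V) theta Ohat) /\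
        (forall Ohat, eca_output (Triples x) (U *m V) theta Ohat ->
           exists2 s : 'I_k -> R, is_sign s &
             Ohat `<=` [set s i *: canonical_col h O i | i in setT])) /\
     ((forall i, skewness P (coordinate h i) != 0) ->
      forall (disp' : measure_display) (T' : measurableType disp')
        (Q : probability T' R) (theta : {RV Q >-> borel_cV R k}),
        uniform_on_sphere theta ->
        {ae Q, forall w, forall Ohat,
           eca_output (Triples x) (U *m V) (theta w) Ohat ->
           exists2 s : 'I_k -> R, is_sign s &
             Ohat = [set s i *: canonical_col h O i | i in setT]})).
Proof.
pose sigma i := stddev P (coordinate h i).
have rO := mixing_full_rank hmodel.
have sigma_gt0 i : 0 < sigma i := factors_stddev_gt0 hmodel i.
rewrite (PairsE hmodel); split; first exact: (eca_whitening_exists rO sigma_gt0).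
move=> U V UV.
pose M := whitened_mixing O sigma U V.
have MM : M *m M^T = 1%:M := whitened_mixing_orthogonal UV.
pose lam (theta : 'cV[R]_k) i := skewness P (coordinate h i) * (M^T *m theta) i 0.
have TE theta : (U *m V)^T *m Triples x (U *m V *m theta) *m (U *m V) =
    M *m diag_mx (\row_i lam theta i) *m M^T.
  by rewrite (TriplesE hmodel) (whitened_triples O sigma_gt0 U V).
have canonE i : (Defs.pinv (U *m V))^T *m col i M = canonical_col h O i.
  exact: (pinv_whitened_mixing rO sigma_gt0 UV).
have pinv_col (A : 'M[R]_k) j e i : col j A = e *: col i M ->
    (Defs.pinv (U *m V))^T *m col j A = e *: canonical_col h O i.
  by move=> ->; rewrite -scalemxAr canonE.
split=> [theta|gamma0 disp' T' Q theta unif].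
  split.
    have [A [s [B svd]]] := is_svd_exists MM (TE theta).
    by eexists; exists A, s, B; split; [exact: svd|].
  move=> Ohat [A [s [B [svd ->]]]].
  have [e sign_e [e_col _]] := is_svd_unique_columns MM (TE theta) svd.
  exists e => // _ [j /unique_valueP uj <-]; have [i ji] := e_col j uj.
  by exists i => //; rewrite (pinv_col _ _ _ _ ji).
(* The almost sure event concerns the eigenvalues only, so one null set serves all singular value
   decompositions and all outputs [Ohat]. *)
have := uniform_on_sphere_distinct_sqr unif MM gamma0; apply: filterS.
move=> w lam_inj Ohat [A [s [B [svd ->]]]].
have [e sign_e [e_col col_e]] := is_svd_unique_columns MM (TE (theta w)) svd.
exists e => //; apply/seteqP; split => [_ [j /unique_valueP uj <-]|_ [i _ <-]].
  by have [i ji] := e_col j uj; exists i => //; rewrite (pinv_col _ _ _ _ ji).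
have [j uj ji] := col_e lam_inj i.
by exists j; [exact/unique_valueP|rewrite (pinv_col _ _ _ _ ji)].
Qed.
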